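(* Let $t,\theta>0$ and $\lambda>1$. Then $$\rho_{t,\theta,\lambda}=D_{t(\lambda-1)}\Big(\gamma\big(\tfrac{t}{\theta(\lambda-1)},1\big)\circledast\gamma\big(1+\tfrac t\theta,1\big)^{\langle-1\rangle}\Big)=\rho_{t,\theta,1}\circledast\gamma\Big(\frac{t}{\theta(\lambda-1)},\frac{\theta(\lambda-1)}{t}\Big),$$ and $\rho_{t,\theta,\lambda}$ is (classically) selfdecomposable. In particular $\rho_{t,\theta,1+t/\theta}=\rho_{t,\theta,1}\circledast\gamma(1,1)$, so it is a mixture of exponential distributions (the law of $EZ$ with $E$ exponential and $Z\ge0$ independent).
   Context: For $t,\theta>0,\lambda\ge1$ define on $(0,\infty)$ the potential $V_{t,\theta,1}(x)=(2+\frac t\theta)\log x+\frac{t^2}{\theta x}$ and, for $\lambda>1$, $V_{t,\theta,\lambda}(x)=\big(1-\frac{t}{\theta(\lambda-1)}\big)\log x+\big(1+\frac{t\lambda}{\theta(\lambda-1)}\big)\log(x+t(\lambda-1))$. The Gibbs measure is $\rho_{t,\theta,\lambda}(dx)=\mathcal Z_{t,\theta,\lambda}^{-1}e^{-V_{t,\theta,\lambda}(x)}\mathbf 1_{(0,\infty)}(x)dx$ with $\mathcal Z_{t,\theta,\lambda}=\int_0^\infty e^{-V_{t,\theta,\lambda}(x)}dx$. The gamma distribution is $\gamma(a,b)(dx)=\frac{1}{b^a\Gamma(a)}x^{a-1}e^{-x/b}\mathbf 1_{(0,\infty)}(x)dx$. For $\mu$ on $(0,\infty)$, $\mu^{\langle-1\rangle}(B)=\mu(\{x^{-1}:x\in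 B\})$; $D_c(\mu)(B)=\mu(\{x/c:x\in B\})$. $\circledast$ denotes classical multiplicative convolution (law of the product of independent random variables). *)

(* Defs.v *)
From HB Require Import structures.
From mathcomp Require Import all_boot all_order all_algebra.
From mathcomp Require Import all_classical all_reals all_analysis.
From mathcomp Require Import measurable_realfun exponential_distribution.

Set Implicit Arguments.
Unset Strict Implicit.
Unset Printing Implicit Defensive.

Import Order.TTheory GRing.Theory Num.Def Num.Theory.

Local Open Scope classical_set_scope.
Local Open Scope ring_scope.

Section density_measure.
Context {R : realType}.
Notation mu := (@lebesgue_measure R).

(* A density is used as-is when it is measurable and nonnegative (which is
   the case for all densities below); the guard only serves to make the
   induced set function unconditionally a measure. *)
Definition dens (f : R -> R) : R -> R := fun x =>
  if `[< measurable_fun [set: R] f /\ (forall y, 0 <= f y) >] then f x else 0.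

Lemma dens_ge0 f x : 0 <= dens f x.
Proof.
rewrite /dens; case: asboolP => [[_ ->]|_] //.
Qed.

Lemma measurable_dens f : measurable_fun [set: R] (dens f).
Proof.
rewrite /dens; case: asboolP => [[mf _]|_].
  by rewrite (_ : (fun x => f x) = f).
exact: measurable_cst.
Qed.

Definition dmeas (f : R -> R) (A : set R) : \bar R :=
  (\int[mu]_(x in A) (dens f x)%:E)%E.

Variable f : R -> R.

Let dmeas0 : dmeas f set0 = 0%E.
Proof. by rewrite /dmeas integral_set0. Qed.

Let dmeas_ge0 A : (0 <= dmeas f A)%E.
Proof. by rewrite /dmeas integral_ge0//= => x _; rewrite lee_fin dens_ge0. Qed.

Let dmeas_sigma_additive : semi_sigma_additive (dmeas f).
Proof.
move=> /= F mF tF mUF; rewrite /dmeas; apply: cvg_toP.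
  apply: ereal_nondecreasing_is_cvgn => m n mn.
  apply: lee_sum_nneg_natr => // k _ _; apply: integral_ge0 => /= x Fkx.
  by rewrite lee_fin dens_ge0.
rewrite ge0_integral_bigcup//=.
- apply/measurable_EFinP; apply: measurable_funTS.
  exact: measurable_dens.
- by move=> x _; rewrite lee_fin dens_ge0.
Qed.

HB.instance Definition _ := isMeasure.Build _ _ _
  (dmeas f) dmeas0 dmeas_ge0 dmeas_sigma_additive.

End density_measure.

Section defs.
Context {R : realType}.
Notation mu := (@lebesgue_measure R).

Definition Gamma (a : R) : R :=
  fine (\int[mu]_(x in `]0%R, +oo[) (x `^ (a - 1) * expR (- x))%:E)%E.

Definition gamma_pdf (a b : R) (x : R) : R :=
  if 0 < x then x `^ (a - 1) * expR (- (x / b)) / (b `^ a * Gamma a) else 0.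

Definition gamma_dist (a b : R) := dmeas (gamma_pdf a b).

(* the potential V_{t,θ,λ} (meaningful for λ >= 1) *)
Definition Vpot (t th lam : R) (x : R) : R :=
  if lam == 1 then (2 + t / th) * ln x + t ^+ 2 / (th * x)
  else (1 - t / (th * (lam - 1))) * ln x
       + (1 + t * lam / (th * (lam - 1))) * ln (x + t * (lam - 1)).

Definition Zpot (t th lam : R) : \bar R :=
  (\int[mu]_(x in `]0%R, +oo[) (expR (- Vpot t th lam x))%:E)%E.

Definition rho_pdf (t th lam : R) (x : R) : R :=
  if 0 < x then expR (- Vpot t th lam x) / fine (Zpot t th lam) else 0.

Definition rho (t th lam : R) := dmeas (rho_pdf t th lam).

Definition inv_meas (m : set R -> \bar R) (B : set R) : \bar R :=
  m ((fun x => x^-1) @` B).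

Definition Dil (c : R) (m : set R -> \bar R) (B : set R) : \bar R :=
  m ((fun x => x / c) @` B).

Definition mconv (m1 : {measure set R -> \bar R})
  (m2 : set R -> \bar R) (B : set R) : \bar R :=
  (\int[m1]_x m2 [set y | (x * y)%R \in B])%E.

Definition aconv (m1 : {measure set R -> \bar R})
  (m2 : set R -> \bar R) (B : set R) : \bar R :=
  (\int[m1]_x m2 [set y | (x + y)%R \in B])%E.

Definition selfdecomposable (m : set R -> \bar R) : Prop :=
  forall c : R, 0 < c < 1 ->
    exists nu : probability R R,
      forall B : set R, measurable B -> m B = aconv nu (Dil c m) B.

End defs.

(* Main.v *)
(** Both product formulas are computations with densities: scaling and Tonelli
    turn each product into a constant times [expR (- Vpot t th lam u)], and the
    constant is forced by total mass one.

    For selfdecomposability write [a = t / (th (lam - 1))], [b = 1 + t / th],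
    [c = t (lam - 1)] and let [phi] be the Laplace transform of the unnormalized
    density [x^(a-1) (x+c)^(-(a+b))], a Tricomi function.  Kummer's differential
    equation for [phi] becomes a Riccati equation for
    [W s = a + s phi'(s) / phi(s)], which lies in [0, a] because [b >= 1], and
    integrates to the fixed-point equation
    [W s = \int_0^oo e^(-s c z) (1+z)^(-2a-b-1) (a(a+b) + W(s(1+z))^2) dz].
    Its right-hand side preserves Laplace transforms of finite measures and is a
    contraction, so Picard iteration from [0] shows that [W] is the Laplace
    transform of a finite measure.  Since
    [phi(s) / phi(qs) = q^a exp (\int_q^1 W(su)/u du)], the quotient is again
    such a transform, and its measure is the law complementing the dilation by
    [q]; uniqueness of Laplace transforms concludes. *)
Require Import Defs.
From HB Require Import structures.
From mathcomp Require Import all_boot all_order all_algebra.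
From mathcomp Require Import all_classical all_reals all_analysis.
From mathcomp Require Import measurable_realfun exponential_distribution.
From mathcomp Require Import ring lra.
Import Order.TTheory GRing.Theory Num.Def Num.Theory.
Import numFieldNormedType.Exports.
Local Open Scope classical_set_scope.
Local Open Scope ring_scope.
Set Implicit Arguments.
Unset Strict Implicit.
Unset Printing Implicit Defensive.

(** * Laplace transforms of finite measures *)

(** Why [W] is the right unknown: if [k(x)/x] is the density of the Lévy measure,
    selfdecomposability means that [k] decreases, and then [a - W(s) = - s phi'(s) / phi(s)] is the
    integral of [1 - e^(-s x)] against [- dk]. The measure behind [W] is therefore [- dk], of total
    mass [W(0) = a]. The Riccati equation reads [s W' = (2a + b + c s) W - a(a+b) - W^2]. Its linear
    term goes into the integrating factor [s^(-(2a+b)) e^(-c s)]; the remaining terms all have the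
    same sign, so integrating from [s] to infinity leaves only positive coefficients, and the
    substitution of [s(1+z)] produces the kernel. Squaring is [2a]-Lipschitz on [[0, a]] and the
    kernel has mass [1/(2a+b)], whence a contraction. Started from [0], the iterates grow by
    increments that are themselves Laplace transforms, so the limit measure is simply a countable
    sum of measures. *)

Section laplace_class.
Context {R : realType}.

(* The absolute value makes a support condition on [mu] unnecessary: [h] is the
   Laplace transform of the image of [mu] under [normr]. *)
Definition is_laplace (h : R -> R) := exists mu : {measure set R -> \bar R},
  forall s, 0 <= s -> (\int[mu]_x (expR (- (s * `|x|)))%:E = (h s)%:E)%E.

Lemma measurable_expRNM (s : R) :
  measurable_fun [set: R] (fun x : R => (expR (- (s * `|x|)))%:E).
Proof.
apply/measurable_EFinP; apply: measurableT_comp => //.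
apply: measurableT_comp => //; apply: measurable_funM => //.
Qed.

(** The value at [s = 0] is the total mass, so finiteness is automatic; [mfrestr] on the whole line
    repackages the same measure as a finite one. *)
Lemma is_laplace_finite h : is_laplace h ->
  exists mu : {finite_measure set R -> \bar R},
  forall s, 0 <= s -> (\int[mu]_x (expR (- (s * `|x|)))%:E = (h s)%:E)%E.
Proof.
move=> [mu muh].
have muT : (mu setT < +oo)%E.
  have := muh 0 (lexx _).
  under eq_integral do rewrite mul0r oppr0 expR0.
  by rewrite integral_cst//= mul1e => ->; rewrite ltry.
exists (mfrestr measurableT muT) => s s0; rewrite -muh//.
by apply: eq_measure_integral => A mA _; rewrite /= /mfrestr /mrestr setIT.
Qed.

Lemma is_laplace_ge0 h s : is_laplace h -> 0 <= s -> 0 <= h s.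
Proof.
move=> [mu muh] s0; rewrite -lee_fin -muh//.
by apply: integral_ge0 => x _; rewrite lee_fin expR_ge0.
Qed.

Lemma is_laplace_cst (c : R) : 0 <= c -> is_laplace (fun=> c).
Proof.
move=> c0; exists (mscale (NngNum c0) (dirac (0 : R))) => s s0.
rewrite ge0_integral_mscale//; last exact: measurable_expRNM.
rewrite integral_dirac//; last exact: measurable_expRNM.
by rewrite diracT mul1e normr0 mulr0 oppr0 expR0 mule1.
Qed.

Lemma is_laplaceD h1 h2 : is_laplace h1 -> is_laplace h2 ->
  is_laplace (fun s => h1 s + h2 s).
Proof.
move=> [m1 H1] [m2 H2]; exists (measure_add m1 m2) => s s0.
rewrite ge0_integral_measure_add//; last exact: measurable_expRNM.
by rewrite H1// H2.
Qed.

Lemma eq_is_laplace h1 h2 : (forall s, 0 <= s -> h1 s = h2 s) ->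
  is_laplace h1 -> is_laplace h2.
Proof. by move=> e [m H]; exists m => s s0; rewrite -e// H. Qed.

(** The measures of the terms are added up; convergence at [s = 0] bounds the mass of the sum. *)
Lemma is_laplace_series (d : (R -> R)^nat) h : (forall n, is_laplace (d n)) ->
  (forall s, 0 <= s -> series (d ^~ s) n @[n --> \oo] --> h s) ->
  is_laplace h.
Proof.
move=> /boolp.choice[m mh] dh; exists (mseries m 0) => s s0.
rewrite ge0_integral_measure_series//; last exact: measurable_expRNM.
under eq_eseriesr do rewrite mh//.
apply/cvg_lim => //.
rewrite [X in X @ _](_ : _ = EFin \o series (d ^~ s)); last first.
  by apply/funext => n /=; rewrite sumEFin.
by apply: cvg_EFin; [exact: nearW|exact: dh].
Qed.

(** The image of [m1 \x m2] under [g] is the required measure. Products and mixtures both reduce to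
    a choice of [g]. *)
Lemma is_laplace_pushforward
    (m1 m2 : {finite_measure set R -> \bar R}) (g : R * R -> R) (h : R -> R) :
  measurable_fun setT g -> (forall p, 0 <= g p) ->
  (forall s, 0 <= s ->
    (\int[m1]_x \int[m2]_y (expR (- (s * g (x, y))))%:E = (h s)%:E)%E) ->
  is_laplace h.
Proof.
move=> mg g0 gh.
exists (pushforward (m1 \x m2)%E g) => s s0.
have mE : measurable_fun [set: R * R] (fun p => (expR (- (s * g p)))%:E).
  apply/measurable_EFinP; apply: measurableT_comp => //.
  by apply: measurableT_comp => //; apply: measurable_funM.
rewrite (ge0_integral_pushforward mg)//; last exact: measurable_expRNM.
rewrite preimage_setT -gh//.
rewrite -(fubini_tonelli1 (fun p => (expR (- (s * g p)))%:E))//.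
by apply: eq_integral => p _ /=; rewrite ger0_norm.
Unshelve. exact: mg. Qed.

Lemma is_laplaceM (h1 h2 : R -> R) : is_laplace h1 -> is_laplace h2 ->
  is_laplace (fun s => h1 s * h2 s).
Proof.
move=> /is_laplace_finite[m1 H1] /is_laplace_finite[m2 H2].
apply: (@is_laplace_pushforward m1 m2 (fun p => `|p.1| + `|p.2|)) => //.
- by apply: measurable_funD; apply: measurableT_comp.
move=> s s0 /=.
under eq_integral => x _.
  under eq_integral do rewrite mulrDr opprD expRD EFinM.
  rewrite ge0_integralZl//; last exact: measurable_expRNM.
  rewrite H2//.
  over.
rewrite ge0_integralZr//; last 2 first.
  exact: measurable_expRNM.
  by rewrite lee_fin; apply: (is_laplace_ge0 (h := h2)) => //; exists m2.
by rewrite H1.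
Qed.

Lemma is_laplaceX (h : R -> R) n : is_laplace h -> is_laplace (fun s => h s ^+ n).
move=> hh; elim: n => [|n ih].
  by apply: (eq_is_laplace _ (is_laplace_cst ler01)) => s _; rewrite expr0.
by apply: eq_is_laplace (is_laplaceM hh ih) => s _; rewrite exprS.
Qed.

(** The exponential series has nonnegative coefficients: up to normalization the measure is a
    compound Poisson law. *)
Lemma is_laplace_expR (h : R -> R) : is_laplace h -> is_laplace (fun s => expR (h s)).
Proof.
move=> hh; apply: (is_laplace_series (d := fun n s => n`!%:R^-1 * h s ^+ n)).
  move=> n; apply: is_laplaceM; last exact: is_laplaceX.
  by apply: is_laplace_cst; rewrite invr_ge0.
move=> s s0.
have -> : (fun n => n`!%:R^-1 * h s ^+ n) = exp_coeff (h s).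
  by apply/funext => n; rewrite /exp_coeff /= mulrC.
exact: is_cvg_series_exp_coeff.
Qed.

(** [h] is constrained on the half-line only, hence the sign condition on [b]. Measurability comes
    from writing [h (b x)] as the inner integral of Tonelli's theorem. *)
Lemma measurable_is_laplace_comp (h b : R -> R) : is_laplace h ->
  measurable_fun setT b -> (forall x, 0 <= b x) ->
  measurable_fun setT (fun x => h (b x)).
Proof.
move=> /is_laplace_finite[m H] mb b0.
have mE : measurable_fun [set: R * R] (fun p => (expR (- (b p.1 * `|p.2|)))%:E).
  apply/measurable_EFinP; apply: measurableT_comp => //.
  apply: measurableT_comp => //; apply: measurable_funM => //.
    exact: measurableT_comp.
  by apply: measurableT_comp => //; exact: measurableT_comp.
apply/measurable_EFinP.
rewrite [X in measurable_fun _ X](_ : _ =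
    fubini_F m (fun p : R * R => (expR (- (b p.1 * `|p.2|)))%:E)).
  by apply: measurable_fun_fubini_tonelli_F => // p; rewrite lee_fin expR_ge0.
by apply/funext => x; rewrite /fubini_F /= H.
Qed.

(** With [z] drawn from [kappa] and [x] from the measure of [h], this is the transform of
    [a z + b z |x|]. Both the fixed-point map and the integral of [W(s u) / u] have this form. *)
Lemma is_laplace_mixture (kappa : {finite_measure set R -> \bar R})
    (a b h k : R -> R) :
  measurable_fun setT a -> (forall x, 0 <= a x) ->
  measurable_fun setT b -> (forall x, 0 <= b x) -> is_laplace h ->
  (forall s, 0 <= s ->
     (\int[kappa]_z (expR (- (s * a z)) * h (s * b z))%:E = (k s)%:E)%E) ->
  is_laplace k.
Proof.
move=> ma a0 mb b0 hh hk; have [m H] := is_laplace_finite hh.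
apply: (@is_laplace_pushforward kappa m (fun p => a p.1 + b p.1 * `|p.2|)) => //.
- apply: measurable_funD; first exact: measurableT_comp.
  apply: measurable_funM; first exact: measurableT_comp.
  by apply: measurableT_comp => //; exact: measurableT_comp.
- by move=> p; rewrite addr_ge0// mulr_ge0.
move=> s s0 /=; rewrite -hk//; apply: eq_integral => z _.
under eq_integral do rewrite mulrDr opprD expRD EFinM mulrA.
rewrite ge0_integralZl//; last exact: measurable_expRNM.
by rewrite H ?mulr_ge0.
Qed.

Lemma is_laplace_mixture_fin_num (kappa : {finite_measure set R -> \bar R})
    (a b h : R -> R) (s : R) : 0 <= s ->
  measurable_fun setT a -> (forall x, 0 <= a x) ->
  measurable_fun setT b -> (forall x, 0 <= b x) -> is_laplace h ->
  (\int[kappa]_z (expR (- (s * a z)) * h (s * b z))%:E \is a fin_num)%E.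
Proof.
move=> s0 ma a0 mb b0 hh.
have h0 x : 0 <= h (s * b x) by apply: is_laplace_ge0 => //; rewrite mulr_ge0.
rewrite ge0_fin_numE; last first.
  by apply: integral_ge0 => z _; rewrite lee_fin mulr_ge0// expR_ge0.
(* Transforms decrease in their argument, so [h 0] dominates the integrand, and [kappa] is
   finite. *)
apply: (@le_lt_trans _ _ (\int[kappa]_z (h 0)%:E)%E); last first.
  rewrite integral_cst// lte_mul_pinfty ?lee_fin//; first exact: is_laplace_ge0.
  by rewrite -ge0_fin_numE// fin_num_measure.
apply: ge0_le_integral => //.
- by move=> z _; rewrite lee_fin mulr_ge0// expR_ge0.
- apply/measurable_EFinP; apply: measurable_funM.
    apply: measurableT_comp => //; apply: measurableT_comp => //.
    exact: measurable_funM.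
  apply: measurable_is_laplace_comp => //; first exact: measurable_funM.
  by move=> x; rewrite mulr_ge0.
move=> z _; rewrite lee_fin -[leRHS]mul1r ler_pM ?expR_ge0//.
  by rewrite -expR0 ler_expR oppr_le0 mulr_ge0.
have [m H] := hh; rewrite -lee_fin -!H ?mulr_ge0//.
apply: ge0_le_integral => //; try exact: measurable_expRNM.
by move=> x _; rewrite lee_fin ler_expR mul0r oppr0 oppr_le0 !mulr_ge0.
Qed.

End laplace_class.

(** * Picard iteration for a quadratic fixed-point equation *)

Section quadratic_fixpoint.
Context {R : realType}.
Variables (kappa : {finite_measure set R -> \bar R}) (D a m0 c0 : R).
Hypotheses (D0 : 0 < D) (kD : kappa setT = (D^-1)%:E).
Hypotheses (a0 : 0 <= a) (aD : 2 * a < D) (m0_ge0 : 0 <= m0) (c0_ge0 : 0 <= c0).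

Let S (h : R -> R) (s : R) : R :=
  fine (\int[kappa]_z (expR (- (s * (c0 * `|z|))) * h (s * (1 + `|z|)))%:E)%E.

Let malpha : measurable_fun setT (fun z : R => c0 * `|z|).
Proof. by apply: measurable_funM => //; exact: measurableT_comp. Qed.

Let alpha0 (z : R) : 0 <= c0 * `|z|. Proof. by rewrite mulr_ge0. Qed.

Let mbeta : measurable_fun setT (fun z : R => 1 + `|z|).
Proof. by apply: measurable_funD => //; exact: measurableT_comp. Qed.

Let beta0 (z : R) : 0 <= 1 + `|z|. Proof. by rewrite addr_ge0. Qed.

Let SE h (s : R) : is_laplace h -> 0 <= s ->
  (\int[kappa]_z (expR (- (s * (c0 * `|z|))) * h (s * (1 + `|z|)))%:E
   = (S h s)%:E)%E.
Proof.
by move=> hh s0; rewrite /S fineK//; exact: is_laplace_mixture_fin_num.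
Qed.

Let is_laplace_S h : is_laplace h -> is_laplace (S h).
Proof.
by move=> hh; apply: (is_laplace_mixture malpha alpha0 mbeta beta0 hh) => s s0; exact: SE.
Qed.

Let measurable_integrand (h : R -> R) (s : R) :
  measurable_fun setT (fun z : R => h (s * (1 + `|z|))) ->
  measurable_fun [set: R] (fun z : R =>
    (expR (- (s * (c0 * `|z|))) * h (s * (1 + `|z|)))%:E).
Proof.
move=> mh; apply/measurable_EFinP; apply: measurable_funM => //.
by apply: measurableT_comp => //; apply: measurableT_comp => //; exact: measurable_funM.
Qed.

Let measurable_laplace (h : R -> R) (s : R) : is_laplace h -> 0 <= s ->
  measurable_fun setT (fun z : R => h (s * (1 + `|z|))).
Proof.
move=> hh s0; apply: measurable_is_laplace_comp => //; first exact: measurable_funM.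
by move=> z; rewrite mulr_ge0.
Qed.

Let SD h1 h2 (s : R) : is_laplace h1 -> is_laplace h2 -> 0 <= s ->
  S (fun s => h1 s + h2 s) s = S h1 s + S h2 s.
Proof.
move=> H1 H2 s0; apply/EFin_inj; rewrite EFinD -!SE//; last exact: is_laplaceD.
rewrite -ge0_integralD//.
- by apply: eq_integral => z _; rewrite -EFinD mulrDr.
- by move=> z _; rewrite lee_fin mulr_ge0 ?expR_ge0// is_laplace_ge0// mulr_ge0.
- by apply: measurable_integrand; exact: measurable_laplace.
- by move=> z _; rewrite lee_fin mulr_ge0 ?expR_ge0// is_laplace_ge0// mulr_ge0.
- by apply: measurable_integrand; exact: measurable_laplace.
Qed.

Let eqS (h1 h2 : R -> R) (s : R) : (forall s, 0 <= s -> h1 s = h2 s) -> 0 <= s -> S h1 s = S h2 s.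
Proof.
move=> h12 s0; congr fine; apply: eq_integral => z _.
by rewrite h12// mulr_ge0.
Qed.

(* The Picard iterates [M n] of [W = S (m0 + W^2)], together with their
   increments [d n = M n.+1 - M n = S (d n.-1 * (2 * M n.-1 + d n.-1))]; the
   latter formula makes the increments Laplace transforms too. *)
Let it (n : nat) : (R -> R) * (R -> R) := iter n
  (fun p => (fun s => p.1 s + p.2 s, S (fun s => p.2 s * (2 * p.1 s + p.2 s))))
  (fun=> 0, S (fun=> m0)).
Let M n := (it n).1.
Let d n := (it n).2.

Let is_laplace_it n : is_laplace (M n) /\ is_laplace (d n).
Proof.
elim: n => [|n [ihM ihd]]; split.
- exact: is_laplace_cst.
- exact/is_laplace_S/is_laplace_cst.
- exact: is_laplaceD.
- apply: is_laplace_S; apply: is_laplaceM => //; apply: is_laplaceD => //.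
  by apply: is_laplaceM => //; exact: is_laplace_cst.
Qed.

Let is_laplace_quad (h : R -> R) : is_laplace h -> is_laplace (fun s => m0 + h s ^+ 2).
Proof.
move=> hh; apply: is_laplaceD; first exact: is_laplace_cst.
exact: is_laplaceX.
Qed.

Let MS n s : 0 <= s -> M n.+1 s = S (fun s => m0 + M n s ^+ 2) s.
Proof.
have [lM ld] := is_laplace_it n.
elim: n s lM ld => [|n ih] s lM ld s0.
  by rewrite /M /it /= add0r; apply: eqS => // x _; rewrite expr0n /= addr0.
have [lM' ld'] := is_laplace_it n.
rewrite -[LHS]/(M n.+1 s + d n.+1 s) ih// -SD//; last 2 first.
- exact: is_laplace_quad.
- apply: is_laplaceM => //; apply: is_laplaceD => //.
  by apply: is_laplaceM => //; exact: is_laplace_cst.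
apply: eqS => // x x0; rewrite -[M n.+1 x]/(M n x + d n x) -/(M n) -/(d n).
by ring.
Qed.

Let M_series n s : M n s = series (d ^~ s) n.
Proof.
elim: n => [|n ih]; first by rewrite /series /= big_geq.
by rewrite -[LHS]/(M n s + d n s) ih /series /= big_nat_recr.
Qed.

(** The iterates stay below [W], and the gap after [n] steps is at most [a * q ^+ n]. Hence [W] is
    the sum of the increments, each of which is a Laplace transform. *)
Lemma is_laplace_quadratic_fixpoint (W : R -> R) :
  (forall s, 0 <= s -> 0 <= W s <= a) ->
  (forall s, 0 <= s -> measurable_fun setT (fun z : R => W (s * (1 + `|z|)))) ->
  (forall s, 0 <= s -> (\int[kappa]_z
    (expR (- (s * (c0 * `|z|))) * (m0 + W (s * (1 + `|z|)) ^+ 2))%:E = (W s)%:E)%E) ->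
  is_laplace W.
Proof.
(* [2 * a] is the Lipschitz constant of squaring on [[0, a]], and [D^-1] is the mass of [kappa]. *)
move=> Wa mW WS; pose q := 2 * a / D.
have q01 : 0 <= q < 1.
  by rewrite divr_ge0 ?mulr_ge0 ?(ltW D0)//= ltr_pdivrMr// mul1r.
have MW n s : 0 <= s -> M n s <= W s <= M n s + a * q ^+ n.
  elim: n s => [|n ih] s s0; first by rewrite expr0 mulr1 add0r; exact: Wa.
  have [lM _] := is_laplace_it n.
  have mM2 : measurable_fun setT (fun z : R => m0 + M n (s * (1 + `|z|)) ^+ 2).
    by apply: (measurable_laplace (is_laplace_quad lM)).
  have mW2 : measurable_fun setT (fun z : R => m0 + W (s * (1 + `|z|)) ^+ 2).
    by apply: measurable_funD => //; apply: measurable_funX; exact: mW.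
  have sz (z : R) : 0 <= s * (1 + `|z|) by rewrite mulr_ge0.
  have M0 x : 0 <= x -> 0 <= M n x by move=> x0; exact: (is_laplace_ge0 lM).
  apply/andP; split.
    rewrite -lee_fin -WS// MS// -SE//; last exact: is_laplace_quad.
    apply: ge0_le_integral => //.
    + by move=> z _; rewrite lee_fin mulr_ge0 ?expR_ge0// addr_ge0// sqr_ge0.
    + exact: (measurable_integrand (h := fun x => m0 + M n x ^+ 2)).
    + exact: (measurable_integrand (h := fun x => m0 + W x ^+ 2)).
    move=> z _; rewrite lee_fin ler_wpM2l ?expR_ge0// lerD2l.
    by rewrite lerXn2r// ?nnegrE ?M0//; have /andP[] := Wa _ (sz z);
      have /andP[] := ih _ (sz z).
  rewrite -lee_fin EFinD -WS// MS// -SE//; last exact: is_laplace_quad.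
  (* The error term is spread over [kappa] as a constant, so that the bound becomes a pointwise
     comparison of integrands. *)
  have -> : (a * q ^+ n.+1)%:E = (\int[kappa]_z (2 * a * (a * q ^+ n))%:E)%E.
    rewrite integral_cst// [X in (_ * X)%E]kD -EFinM exprS; congr EFin; rewrite /q; field.
    by rewrite gt_eqF.
  have qn0 : 0 <= q ^+ n by rewrite exprn_ge0//; case/andP: q01.
  rewrite -ge0_integralD//; last 3 first.
  + by move=> z _; rewrite lee_fin mulr_ge0 ?expR_ge0// addr_ge0// sqr_ge0.
  + exact: (measurable_integrand (h := fun x => m0 + M n x ^+ 2)).
  + by move=> z _; rewrite lee_fin !mulr_ge0.
  apply: ge0_le_integral => //.
  + by move=> z _; rewrite lee_fin mulr_ge0 ?expR_ge0// addr_ge0// sqr_ge0.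
  + exact: (measurable_integrand (h := fun x => m0 + W x ^+ 2)).
  + apply: emeasurable_funD => //.
    exact: (measurable_integrand (h := fun x => m0 + M n x ^+ 2)).
  move=> z _; rewrite -EFinD lee_fin.
  set E := expR _; set x := s * _.
  have E1 : 0 <= E <= 1.
    by rewrite expR_ge0 -expR0 ler_expR oppr_le0 mulr_ge0.
  have /andP[MWx WMx] := ih _ (sz z); have /andP[W0x Wax] := Wa _ (sz z).
  have M0x := M0 _ (sz z); rewrite -/x in MWx WMx W0x Wax M0x.
  (* [W^2 - M^2 = (W - M)(W + M)] with [W - M <= a q^n] and [W + M <= 2a]. *)
  have key : W x ^+ 2 <= M n x ^+ 2 + 2 * a * (a * q ^+ n).
    rewrite -lerBlDl subr_sqr mulrC ler_pM ?subr_ge0// ?addr_ge0//; lra.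
  apply: (@le_trans _ _ (E * (m0 + M n x ^+ 2) + E * (2 * a * (a * q ^+ n)))).
    by rewrite -mulrDr ler_wpM2l ?expR_ge0// -addrA lerD2l.
  rewrite lerD2l ler_piMl//; last by case/andP: E1.
  by rewrite !mulr_ge0.
apply: (@is_laplace_series _ d) => [n|s s0]; first by case: (is_laplace_it n).
apply: (@squeeze_cvgr _ _ _ _ (fun n => W s - a * q ^+ n) (fun=> W s)).
- apply: nearW => n; rewrite -M_series lerBlDr.
  by have /andP[-> ->] := MW n s s0.
- rewrite -[X in _ --> X]subr0 -[in X in _ - X](mulr0 a).
  apply: cvgB; first exact: cvg_cst.
  apply: cvgMr; apply: cvg_expr; case/andP: q01 => q0 q1.
  by rewrite ger0_norm.
- exact: cvg_cst.
Qed.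
End quadratic_fixpoint.

(** * Uniqueness of Laplace transforms on the half-line *)

Section laplace_uniqueness.
Context {R : realType}.

(* By Bernoulli's inequality [(1 - u^(2n))^(n 4^n)] tends to the indicator of
   [2 u < 1]; with [u = expR (- (s * `|x|))] its integral is a combination of
   values of the Laplace transform and tends to the measure of a tail. *)
Lemma onemX_ge_bernoulli (v : R) n : 0 <= v <= 1 -> 1 - n%:R * v <= (1 - v) ^+ n.
Proof.
move=> /andP[v0 v1]; elim: n => [|n ih]; first by rewrite mul0r subr0 expr0.
rewrite exprS; apply: (@le_trans _ _ ((1 - v) * (1 - n%:R * v))).
  have := ler0n R n; rewrite -natr1; nra.
by rewrite ler_wpM2l// subr_ge0.
Qed.

Lemma onemX_le_bernoulli (v : R) n : 0 <= v <= 1 -> (1 - v) ^+ n * (1 + n%:R * v) <= 1.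
Proof.
move=> /andP[v0 v1]; elim: n => [|n ih]; first by rewrite expr0 mul0r addr0 mulr1.
apply: le_trans ih; rewrite exprSr -mulrA ler_wpM2l ?exprn_ge0 ?subr_ge0//.
have := ler0n R n; rewrite -natr1; nra.
Qed.

(** [1 - w^n = (1 - w)(1 + w + ... + w^(n-1))], and each of the [n] summands is at least [w^n]. This
    bounds [n w^n] uniformly in [n] when [w < 1]. *)
Lemma natrM_expr_le (w : R) n : 0 <= w <= 1 -> n%:R * (1 - w) * w ^+ n <= 1 - w ^+ n.
Proof.
move=> /andP[w0 w1]; elim: n => [|n ih]; first by rewrite expr0 !mul0r subrr.
have wn : 0 <= w ^+ n <= 1 by rewrite exprn_ge0// exprn_ile1.
rewrite exprS -natr1; move: ih wn; set y := w ^+ n; set k := n%:R => ih /andP[y0 y1].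
have h1 : w * (k * (1 - w) * y) <= w * (1 - y) by rewrite ler_wpM2l.
have h2 : 0 <= (1 - w) * (1 - w * y).
  by rewrite mulr_ge0 ?subr_ge0// mulr_ile1.
rewrite -subr_ge0 in h1; rewrite -subr_ge0.
apply: le_trans (addr_ge0 h1 h2) _; rewrite le_eqVlt; apply/orP; left.
by apply/eqP; ring.
Qed.

Lemma onemX_cvg1 (u : R) : 0 <= u -> 2 * u < 1 ->
  (1 - u ^+ n.*2) ^+ (n * 4 ^ n) @[n --> \oo] --> (1 : R).
Proof.
move=> u0 u2; set w := 2 * u; have w0 : 0 <= w by rewrite mulr_ge0.
have u2n n : 0 <= u ^+ n.*2 <= 1.
  by rewrite exprn_ge0//= exprn_ile1//; lra.
apply: (@squeeze_cvgr _ _ _ _ (fun n => 1 - (1 - w)^-1 * w ^+ n) (fun=> 1)).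
- apply: nearW => n; apply/andP; split; last first.
    by apply: exprn_ile1; have /andP[? ?] := u2n n; lra.
  apply: le_trans (onemX_ge_bernoulli _ (u2n n)); rewrite lerD2l lerN2.
  (* The count [n 4^n] turns [u^(2n)] into [n w^(2n)] with [w = 2u < 1]; one factor [w^n] absorbs
     [n], the other tends to [0]. *)
  have -> : (n * 4 ^ n)%:R * u ^+ n.*2 = n%:R * w ^+ n * w ^+ n.
    rewrite natrM natrX -!mulrA; congr (_ * _).
    rewrite -exprD addnn /w exprMn; congr (_ * _).
    by rewrite -mul2n exprM; congr (_ ^+ _); ring.
  rewrite ler_wpM2r ?exprn_ge0// -[leRHS]mul1r ler_pdivlMr ?subr_gt0//.
  rewrite mulrAC; apply: le_trans (natrM_expr_le _ _) _.
    by rewrite w0 ltW.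
  by rewrite lerBlDr lerDl exprn_ge0.
- have : (1 - w)^-1 * w ^+ n @[n --> \oo] --> (1 - w)^-1 * 0.
    by apply: cvgMr; apply: cvg_expr; rewrite ger0_norm.
  by move=> /(cvgB (cvg_cst (1 : R))); rewrite mulr0 subr0.
- exact: cvg_cst.
Qed.

Lemma onemX_cvg0 (u : R) : u <= 1 -> 1 <= 2 * u ->
  (1 - u ^+ n.*2) ^+ (n * 4 ^ n) @[n --> \oo] --> (0 : R).
Proof.
move=> u1 u2; have u0 : 0 <= u by lra.
have u2n n : 0 <= u ^+ n.*2 <= 1 by rewrite exprn_ge0//= exprn_ile1.
apply: (@squeeze_cvgr _ _ _ _ (fun=> 0) (fun n => n.+1%:R^-1)).
- apply: nearW => n; apply/andP; split.
    by rewrite exprn_ge0// subr_ge0; case/andP: (u2n n).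
  rewrite -[leRHS]mul1r ler_pdivlMr//.
  (* Since [1 <= 2u], also [4^n u^(2n) >= 1], and the Bernoulli factor is at least [1 + n]. At the
     threshold [2u = 1] the extra factor [n] in the exponent is what forces the limit [0]. *)
  apply: le_trans (onemX_le_bernoulli (n * 4 ^ n) (u2n n)).
  rewrite ler_wpM2l//; first by rewrite exprn_ge0// subr_ge0; case/andP: (u2n n).
  rewrite -natr1 addrC lerD2l natrM natrX -mulrA ler_peMr//.
  rewrite -mul2n exprM -exprMn exprn_ege1//; nra.
- exact: cvg_cst.
- exact: cvg_harmonic.
Qed.

Section uniqueness.
Variables m1 m2 : {finite_measure set R -> \bar R}.
Hypothesis m12 : forall s, 0 <= s ->
  (\int[m1]_x (expR (- (s * `|x|)))%:E = \int[m2]_x (expR (- (s * `|x|)))%:E)%E.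

(** Test functions on which the two measures agree; the bound by [1] is the domination used to pass
    to limits. *)
Let P (f : R -> R) := [/\ measurable_fun setT f, forall x, 0 <= f x <= 1 &
  (\int[m1]_x (f x)%:E = \int[m2]_x (f x)%:E)%E].

Let integrable_bounded (m : {finite_measure set R -> \bar R}) (f : R -> R) :
  measurable_fun setT f -> (forall x, 0 <= f x <= 1) -> m.-integrable setT (EFin \o f).
Proof.
move=> mf f01; apply: (@le_integrable _ _ _ _ _ _ _ (fun=> 1%E)) => //.
- exact/measurable_EFinP.
- move=> x _ /=; have /andP[f0 f1] := f01 x.
  by rewrite lee_fin ger0_norm// normr1.
- apply/integrableP; split => //.
  under eq_integral do rewrite abse1.
  by rewrite integral_cst// mul1e -ge0_fin_numE// fin_num_measure.
Qed.

(** Expanding one factor [1 - e^(-t |x|)] gives a difference of two instances, at [r] and at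
    [r + t]; hence the induction runs over all [r]. *)
Let expPn (r t : R) n : 0 <= r -> 0 <= t ->
  P (fun x => expR (- (r * `|x|)) * (1 - expR (- (t * `|x|))) ^+ n).
Proof.
have e01 (s x : R) : 0 <= s -> 0 <= expR (- (s * `|x|)) <= 1.
  by move=> s0; rewrite expR_ge0 -expR0 ler_expR oppr_le0 mulr_ge0.
have me (s : R) : measurable_fun [set: R] (fun x => expR (- (s * `|x|))).
  apply: measurableT_comp => //; apply: measurableT_comp => //.
  exact: measurable_funM.
move=> r0 t0.
have bnd (r' : R) n' (x : R) : 0 <= r' ->
    0 <= expR (- (r' * `|x|)) * (1 - expR (- (t * `|x|))) ^+ n' <= 1.
  move=> r0'; have /andP[e0 e1] := e01 r' x r0'; have /andP[f0 f1] := e01 t x t0.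
  have /andP[g0 g1] : 0 <= (1 - expR (- (t * `|x|))) ^+ n' <= 1.
    by rewrite exprn_ge0 ?subr_ge0//= exprn_ile1 ?subr_ge0// lerBlDr lerDl.
  by rewrite mulr_ge0//= mulr_ile1.
have mn (r' : R) n' : measurable_fun [set: R]
    (fun x => expR (- (r' * `|x|)) * (1 - expR (- (t * `|x|))) ^+ n').
  apply: measurable_funM => //; apply: measurable_funX; exact: measurable_funB.
split => //; first by move=> x; exact: bnd.
elim: n r r0 => [|n ih] r r0.
  by under eq_integral do rewrite expr0 mulr1; rewrite m12//;
     under [RHS]eq_integral do rewrite expr0 mulr1.
have E (x : R) : (expR (- (r * `|x|)) * (1 - expR (- (t * `|x|))) ^+ n.+1)%:E =
  ((expR (- (r * `|x|)) * (1 - expR (- (t * `|x|))) ^+ n)%:E -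
   (expR (- ((r + t) * `|x|)) * (1 - expR (- (t * `|x|))) ^+ n)%:E)%E.
  by rewrite -EFinB; congr EFin; rewrite mulrDl opprD expRD exprS; ring.
under eq_integral do rewrite E; under [RHS]eq_integral do rewrite E.
have rt0 : 0 <= r + t by rewrite addr_ge0.
have ib (m : {finite_measure set R -> \bar R}) (r' : R) : 0 <= r' -> m.-integrable setT (EFin \o
    (fun x => expR (- (r' * `|x|)) * (1 - expR (- (t * `|x|))) ^+ n)).
  by move=> r0'; apply: integrable_bounded => // x; exact: bnd.
by rewrite !integralB//; [rewrite !ih|exact: ib..].
Qed.

Let P_lim (f : (R -> R)^nat) (A : set R) : measurable A -> (forall n, P (f n)) ->
  (forall x, f n x @[n --> \oo] --> (\1_A x : R)) -> m1 A = m2 A.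
Proof.
move=> mA Pf fA.
have H (m : {finite_measure set R -> \bar R}) :
    (\int[m]_x (f n x)%:E @[n --> \oo] --> m A)%E.
  have := @dominated_convergence _ _ _ m setT measurableT
    (fun n x => (f n x)%:E) (fun x => (\1_A x)%:E) (fun=> 1%E).
  case.
  - by move=> n; apply/measurable_EFinP; case: (Pf n).
  - exact/measurable_EFinP/measurable_indic.
  - apply/aeW => x _; apply: cvg_EFin; [exact: nearW|exact: fA].
  - by have := @integrable_bounded m (fun=> 1); apply => // x; rewrite ler01 lexx.
  - apply/aeW => x n _; have [_ /(_ x)/andP[f0 f1] _] := Pf n.
    by rewrite /= lee_fin ger0_norm.
  by move=> _ _; rewrite integral_indic// setIT.
have H2 := H m2; have H1 := H m1.
rewrite (_ : (fun n => _) = (fun n => \int[m2]_x (f n x)%:E)%E) in H1.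
  by rewrite -(cvg_lim _ H1)// -(cvg_lim _ H2).
by apply/funext => n; case: (Pf n).
Qed.

Let tail_gt0 (x : R) : 0 < x -> m1 [set y | x < `|y|] = m2 [set y | x < `|y|].
Proof.
(* Chosen so that [2 e^(-t |y|) < 1] holds exactly when [x < |y|], which is [half] below. *)
move=> x0; pose t := ln 2 / x.
have t0 : 0 < t by rewrite divr_gt0// ln_gt0// ltr1n.
have mA : measurable [set y : R | x < `|y|].
  rewrite -[X in measurable X]setTI.
  have -> : [set y : R | x < `|y|] = normr @^-1` `]x, +oo[.
    by apply/seteqP; split => y /=; rewrite in_itv/= andbT.
  exact: normr_measurable.
pose f n (y : R) := (1 - expR (- ((t *+ n.*2) * `|y|))) ^+ (n * 4 ^ n).
have fE n y : f n y = (1 - expR (- (t * `|y|)) ^+ n.*2) ^+ (n * 4 ^ n).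
  by rewrite /f -expRM_natl -mulr_natl mulrN -[in LHS]mulrA.
apply: (P_lim mA (f := f)) => [n|y].
  have := @expPn 0 (t *+ n.*2) (n * 4 ^ n) (lexx _) (mulrn_wge0 _ (ltW t0)).
  rewrite (_ : (fun _ => _) = f n)//.
  by apply/funext => y; rewrite mul0r oppr0 expR0 mul1r.
under eq_cvg do rewrite fE.
have half : (2 * expR (- (t * `|y|)) < 1) = (x < `|y|).
  rewrite -[X in X * _](@lnK _ 2) ?posrE// -expRD -[ltRHS]expR0 ltr_expR subr_lt0.
  by rewrite /t mulrAC ltr_pdivlMr// ltr_pM2l// ln_gt0// ltr1n.
rewrite indicE; have [yA|yA] := boolP (y \in _).
  apply: onemX_cvg1; first exact: expR_ge0.
  by rewrite half; move: yA; rewrite inE.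
apply: onemX_cvg0; first by rewrite -expR0 ler_expR oppr_le0 mulr_ge0// ltW.
by rewrite leNgt half; move: yA; rewrite notin_setE => /= /negP.
Qed.

(** At [x = 0] the rate [ln 2 / x] makes no sense; here [1 - e^(-n |y|)] tends to the indicator. *)
Let tail0 : m1 [set y | 0 < `|y|] = m2 [set y | 0 < `|y|].
Proof.
have mA : measurable [set y : R | 0 < `|y|].
  rewrite -[X in measurable X]setTI.
  have -> : [set y : R | 0 < `|y|] = normr @^-1` `]0, +oo[.
    by apply/seteqP; split => y /=; rewrite in_itv/= andbT.
  exact: normr_measurable.
pose f n (y : R) := 1 - expR (- (n%:R * `|y|)).
apply: (P_lim mA (f := f)) => [n|y].
  have := @expPn 0 n%:R 1 (lexx _) (ler0n _ _).
  rewrite (_ : (fun _ => _) = f n)//.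
  by apply/funext => y; rewrite mul0r oppr0 expR0 mul1r expr1.
rewrite indicE; have [yA|yA] := boolP (y \in _).
  have y0 : 0 < `|y| by move: yA; rewrite inE.
  rewrite -[X in _ --> X]subr0; apply: cvgB; first exact: cvg_cst.
  rewrite (_ : (fun n => _) = (fun n => expR (- `|y|) ^+ n)).
    by apply: cvg_expr; rewrite ger0_norm ?expR_ge0// -expR0 ltr_expR oppr_lt0.
  by apply/funext => n; rewrite -expRM_natl mulrN.
move: yA; rewrite notin_setE /= => /negP; rewrite -leNgt normr_le0 => /eqP ->.
rewrite (_ : f ^~ 0 = fun=> 0); first exact: cvg_cst.
by apply/funext => n; rewrite /f normr0 mulr0 oppr0 expR0 subrr.
Qed.

(** The transforms see only [|x|] and so determine the tails of [|x|]. Without negative mass these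
    are the masses of the rays []x, +oo[] with [x >= 0]; for [x < 0] the ray has full mass. The rays
    generate the Borel sets and are stable under intersection. *)
Lemma laplace_unique : m1 `]-oo, 0[%classic = 0%E -> m2 `]-oo, 0[%classic = 0%E ->
  forall A : set R, measurable A -> m1 A = m2 A.
Proof.
move=> m10 m20.
have mT : m1 setT = m2 setT.
  have := m12 (lexx 0).
  under eq_integral do rewrite mul0r oppr0 expR0.
  under [RHS]eq_integral do rewrite mul0r oppr0 expR0.
  by rewrite !integral_cst// !mul1e.
have split0 (m : {finite_measure set R -> \bar R}) x : 0 <= x ->
    m `]-oo, 0[%classic = 0%E -> m `]x, +oo[%classic = m [set y | x < `|y|].
  move=> x0 mN.
  have -> : [set y : R | x < `|y|] = `]x, +oo[ `|` `]-oo, (- x)[.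
    apply/seteqP; split => y /=; rewrite !in_itv/= andbT.
      have [y0|y0] := leP 0 y; first by rewrite ger0_norm//; left.
      by rewrite ltr0_norm// ltrNr; right.
    case=> [xy|yx]; first by rewrite (lt_le_trans xy)// ler_norm.
    by rewrite ltrNr in yx; rewrite (lt_le_trans yx)// -normrN ler_norm.
  rewrite measureU//; last first.
    by apply/seteqP; split => // y []/=; rewrite !in_itv/= andbT; lra.
  rewrite [X in (_ + X)%E](_ : _ = 0%E) ?adde0//.
  apply: subset_measure0 mN => //.
  by move=> y /=; rewrite !in_itv/=; lra.
apply: (measure_unique (@RGenOInfty.G R) (fun k => `]- k%:R, +oo[%classic)).
- exact: RGenOInfty.measurableE.
- move=> _ _ [x ->] [y ->]; exists (Num.max x y).
  apply/seteqP; split => z /=; rewrite !in_itv/= !andbT ?gt_max.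
    by move=> [-> ->].
  by move=> /andP[].
- by move=> k; exists (- k%:R).
- apply/seteqP; split => // x _; exists (Num.truncn `|x|).+1 => //=.
  rewrite in_itv/= andbT ltrNl; apply: le_lt_trans (truncnS_gt _).
  by rewrite -normrN ler_norm.
- move=> _ [x ->]; have [x0|x0|->] := ltgtP x 0.
  + have H (m : {finite_measure set R -> \bar R}) :
        m `]-oo, 0[%classic = 0%E -> m `]x, +oo[%classic = m setT.
      move=> mN; rewrite -(setUv `]x, +oo[%classic) measureU//.
      - rewrite [X in (_ + X)%E](_ : _ = 0%E) ?adde0// setCitvr.
        by apply: subset_measure0 mN => // y /=; rewrite !in_itv/=; lra.
      - exact: measurableC.
      - exact: setICr.
    exact: etrans (H m1 m10) (etrans mT (esym (H m2 m20))).
  + have x0' := ltW x0.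
    exact: etrans (split0 m1 x x0' m10)
      (etrans (tail_gt0 x0) (esym (split0 m2 x x0' m20))).
  + exact: etrans (split0 m1 0 (lexx _) m10)
      (etrans tail0 (esym (split0 m2 0 (lexx _) m20))).
- by move=> k; rewrite -ge0_fin_numE// fin_num_measure.
Qed.
End uniqueness.
End laplace_uniqueness.

(** * Measures with a density on the half-line *)

Section densities.
Context {R : realType}.
Notation mu := (@lebesgue_measure R).

Lemma dmeasE (f : R -> R) (A : set R) :
  measurable_fun setT f -> (forall x, 0 <= f x) ->
  dmeas f A = (\int[mu]_(x in A) (f x)%:E)%E.
Proof. by move=> mf f0; rewrite /dmeas /dens asboolT. Qed.

Import HBNNSimple.

(** On indicators this is [dmeasE]; simple functions and monotone convergence do the rest. *)
Lemma integral_dmeas (f : R -> R) (g : R -> \bar R) :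
  measurable_fun setT f -> (forall x, 0 <= f x) ->
  measurable_fun setT g -> (forall x, 0 <= g x)%E ->
  (\int[dmeas f]_x g x = \int[mu]_x (g x * (f x)%:E))%E.
Proof.
move=> mf f0 mg g0; pose g_ := nnsfun_approx measurableT mg.
have mEf : measurable_fun setT (EFin \o f) by exact/measurable_EFinP.
have nd m n (x : R) : (m <= n)%N -> g_ m x <= g_ n x.
  by move=> mn; exact/lefP/nd_nnsfun_approx.
have mgf n : measurable_fun setT (fun x => (g_ n x)%:E * (f x)%:E)%E.
  by apply: emeasurable_funM => //; exact/measurable_EFinP.
transitivity (limn (fun n => \int[dmeas f]_x (g_ n x)%:E)%E).
  rewrite -monotone_convergence//.
  - apply: eq_integral => x _; apply/esym/cvg_lim => //.
    exact: cvg_nnsfun_approx.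
  - by move=> n; exact/measurable_EFinP.
  - by move=> n x _; rewrite lee_fin.
  - by move=> x _ m n mn; rewrite lee_fin; exact/lefP/nd_nnsfun_approx.
transitivity (limn (fun n => \int[mu]_x ((g_ n x)%:E * (f x)%:E))%E); last first.
  rewrite -monotone_convergence//.
  - apply: eq_integral => x _; apply/cvg_lim => //.
    apply: cvgeZr => //; exact: cvg_nnsfun_approx.
  - by move=> n x _; apply: mule_ge0; rewrite lee_fin.
  - move=> x _ m n mn; apply: lee_wpmul2r; rewrite lee_fin//.
    exact: nd.
congr (limn _); apply/funext => n.
have mr r : measurable_fun [set: R]
    (fun x : R => (r * \1_(g_ n @^-1` [set r]) x)%:E).
  by apply/measurable_EFinP; apply: measurable_funM.
rewrite integralT_nnsfun sintegralE.
under [RHS]eq_integral => x _.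
  rewrite fimfunE -fsumEFin// ge0_mule_fsuml; last first.
    by move=> r; exact: nnfun_muleindic_ge0.
  over.
rewrite ge0_integral_fsum//; last 2 first.
- by move=> r; apply: emeasurable_funM => //; exact: mr.
- move=> r x _; apply: mule_ge0; last by rewrite lee_fin.
  by rewrite EFinM nnfun_muleindic_ge0.
apply: eq_fsbigr => r; rewrite inE => -[x0 _ <-].
set A := _ @^-1` _.
have mA : measurable A by exact: measurable_funPTI.
rewrite [X in (_ * X)%E](dmeasE _ mf f0) -ge0_integralZl//; last 3 first.
- exact: measurable_funTS.
- by move=> x _; rewrite lee_fin.
- by rewrite lee_fin.
rewrite [LHS]integral_mkcond.
apply: eq_integral => x _; rewrite patchE indicE.
by case: ifPn => _; rewrite ?mulr1 ?mulr0 ?mule0 ?mul0e.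
Qed.

(** [c] times the image of Lebesgue measure under multiplication by [c] gives every half-open
    interval its length, hence is Lebesgue measure. *)
Lemma ge0_integral_scale (c : R) (g : R -> \bar R) : 0 < c ->
  measurable_fun setT g -> (forall x, 0 <= g x)%E ->
  (\int[mu]_x g x = c%:E * \int[mu]_x g (c * x)%R)%E.
Proof.
move=> c0 mg g0.
pose h (x : R) : measurableTypeR R := c * x.
have mh : measurable_fun [set: measurableTypeR R] h by exact: measurable_funM.
have [m [mE <-]] : exists m : {measure set (measurableTypeR R) -> \bar R},
    (forall A, m A = (c%:E * pushforward mu h A)%E) /\
    (\int[m]_x g x = c%:E * \int[mu]_x g (c * x)%R)%E.
  unshelve eexists (mscale (NngNum (ltW c0)) (pushforward mu h)); first exact: mh.
  by split=> //; rewrite ge0_integral_mscale// (ge0_integral_pushforward mh).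
apply: eq_measure_integral => A mA _; apply: lebesgue_measure_unique mA.
move=> _ [[a b] _ <-]; rewrite mE /pushforward /=.
rewrite (_ : _ @^-1` _ = `]a / c, b / c]%classic); last first.
  by apply/seteqP; split => x /=; rewrite !in_itv/= ltr_pdivrMr// ler_pdivlMr//
    (mulrC x).
rewrite !lebesgue_measure_itv/= !lte_fin ltr_pM2r ?invr_gt0//.
case: ifPn => _; last by rewrite mule0.
by rewrite -!EFinD -EFinM; congr EFin; field; rewrite gt_eqF.
Qed.

(** Inversion is discontinuous at [0], where its value is [0] by convention; hence the split by
    sign. *)
Lemma measurable_invr : measurable_fun [set: R] (fun x : R => x^-1).
Proof.
have -> : (fun x : R => x^-1) = (fun x => if 0 < x then expR (- ln x) else
    if x < 0 then - expR (- ln (- x)) else 0).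
  apply/funext => x; case: ltgtP => [x0|x0|<-]; last by rewrite invr0.
    by rewrite expRN lnK ?posrE.
  by rewrite expRN lnK ?posrE ?oppr_gt0// invrN opprK.
apply: measurable_fun_ifT; first exact: measurable_fun_ltr.
  by apply: measurableT_comp => //; exact: measurableT_comp.
apply: measurable_fun_ifT; [exact: measurable_fun_ltr| |by []].
apply: measurableT_comp => //; apply: measurableT_comp => //.
by apply: measurableT_comp => //; apply: measurableT_comp => //; exact: measurableT_comp.
Qed.

Lemma dmeas_product (f g : R -> R) (h : R * R -> R) (B : set R) :
  measurable_fun setT f -> (forall x, 0 <= f x) ->
  measurable_fun setT g -> (forall x, 0 <= g x) ->
  measurable_fun setT h -> measurable B ->
  (\int[dmeas f]_x dmeas g [set y | h (x, y) \in B] =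
   \int[mu]_x \int[mu]_y (f x * g y * \1_B (h (x, y)))%:E)%E.
Proof.
move=> mf f0 mg g0 mh mB.
have mk : measurable_fun [set: R * R] (fun p => (g p.2 * \1_B (h p))%:E).
  apply/measurable_EFinP; apply: measurable_funM; first exact: measurableT_comp.
  by apply: measurableT_comp => //; exact: measurable_indic.
have E x : dmeas g [set y | h (x, y) \in B] = fubini_F mu (fun p => (g p.2 * \1_B (h p))%:E) x.
  rewrite dmeasE// integral_mkcond; apply: eq_integral => y _.
  rewrite patchE indicE /=.
  have [yB|yB] := boolP (h (x, y) \in B).
    by rewrite mem_set// mulr1.
  by rewrite memNset ?mulr0//; exact/negP.
under eq_integral do rewrite E.
rewrite integral_dmeas//; last 2 first.
- by apply: measurable_fun_fubini_tonelli_F => // p; rewrite lee_fin mulr_ge0.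
- by move=> x; apply: integral_ge0 => y _; rewrite lee_fin mulr_ge0.
apply: eq_integral => x _; rewrite muleC -ge0_integralZl//.
- by apply: eq_integral => y _ /=; rewrite -EFinM mulrA.
- by apply: measurableT_comp mk _; exact: measurable_pair1.
- by move=> y _; rewrite lee_fin mulr_ge0.
- by rewrite lee_fin.
Qed.

(** Given [x], the substitution [u = s x * y] shows that [s x * y] has density [g (u / s x) / s x];
    Tonelli then exchanges [x] and [u]. Positivity of [s] is asked only where [f] is nonzero, so
    that [s] can be [c / z] or the identity. *)
Lemma dmeas_scale_mixture (f g s : R -> R) (B : set R) :
  measurable_fun setT f -> (forall x, 0 <= f x) ->
  measurable_fun setT g -> (forall x, 0 <= g x) ->
  measurable_fun setT s -> (forall x, f x != 0 -> 0 < s x) -> measurable B ->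
  (\int[dmeas f]_x dmeas g [set y | (s x * y)%R \in B] =
   \int[mu]_(u in B) \int[mu]_x (f x * (g (u / s x) / s x))%:E)%E.
Proof.
move=> mf f0 mg g0 ms fs mB.
have mh : measurable_fun setT (fun p : R * R => s p.1 * p.2).
  by apply: measurable_funM => //; exact: measurableT_comp.
rewrite (dmeas_product mf f0 mg g0 mh mB).
have ms' : measurable_fun setT (fun p : R * R => (s p.1)^-1).
  by apply: measurableT_comp measurable_invr _; exact: measurableT_comp.
pose k (p : R * R) := (f p.1 * (g (p.2 / s p.1) / s p.1) * \1_B p.2)%:E.
have mk : measurable_fun [set: R * R] k.
  apply/measurable_EFinP; apply: measurable_funM; last first.
    by apply: measurableT_comp => //; exact: measurable_indic.
  apply: measurable_funM; first exact: measurableT_comp.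
  apply: measurable_funM => //; apply: measurableT_comp => //.
  exact: measurable_funM.
have k0 p : (0 <= k p)%E.
  rewrite lee_fin; have [->|/fs sp] := eqVneq (f p.1) 0; first by rewrite !mul0r.
  by rewrite !mulr_ge0// invr_ge0 ltW.
transitivity (\int[mu]_x \int[mu]_u k (x, u))%E.
  apply: eq_integral => x _; rewrite /k/=.
  have [->|/fs sp] := eqVneq (f x) 0.
    by under eq_integral do rewrite !mul0r; under [RHS]eq_integral do rewrite !mul0r.
  have mkx : measurable_fun setT (fun u => k (x, u)).
    by apply: measurableT_comp mk _; exact: measurable_pair1.
  rewrite (ge0_integral_scale sp mkx)//.
  rewrite -ge0_integralZl//; last 2 first.
  - by apply: measurableT_comp mkx _; exact: measurable_funM.
  - by rewrite lee_fin ltW.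
  apply: eq_integral => y _; rewrite /k/= -EFinM; congr EFin.
  rewrite (mulrC (s x) y) mulfK ?gt_eqF//; field; exact/lt0r_neq0.
rewrite (@fubini_tonelli _ _ _ _ _ mu mu k mk k0) [RHS]integral_mkcond.
apply: eq_integral => u _; rewrite patchE /k/= indicE; case: ifPn => uB.
  by apply: eq_integral => x _; rewrite mulr1.
by rewrite integral0_eq// => x _; rewrite mulr0.
Qed.
End densities.

(** * Calculus on the half-line and gamma integrals *)

Section half_line.
Context {R : realType}.
Notation mu := (@lebesgue_measure R).

Lemma integral_ifpos (F : R -> R) :
  (\int[mu]_(x in `]0%R, +oo[) (F x)%:E =
   \int[mu]_x (if 0 < x then F x else 0)%:E)%E.
Proof.
rewrite integral_mkcond; apply: eq_integral => x _.
by rewrite patchE mem_setE in_itv/= andbT; case: ifPn.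
Qed.

Lemma measurable_ifpos (F : R -> R) : measurable_fun setT F ->
  measurable_fun setT (fun x : R => if 0 < x then F x else 0).
Proof.
by move=> mF; apply: measurable_fun_ifT => //; exact: measurable_fun_ltr.
Qed.

Section ftc.
Variables f F : R -> R.
Hypothesis cf : forall x : R, 0 < x -> {for x, continuous f}.
Hypothesis dF : forall x : R, 0 < x -> is_derive x 1 F (f x).

(** An exhaustion of the open half-line, used from index [1] on: [A 0] is the single point [1],
    while [pos_FTC2] wants distinct endpoints. *)
Let A n : set R := `[n.+1%:R^-1, n.+1%:R]%classic.

Lemma pos_FTC2 (a b : R) : 0 < a -> a < b ->
  (\int[mu]_(x in `[a, b]) (f x)%:E = (F b)%:E - (F a)%:E)%E.
Proof.
move=> a0 ab; have cF (x : R) : 0 < x -> {for x, continuous F}.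
  move=> x0; apply: differentiable_continuous; apply/derivable1_diffP.
  by have [] := dF x0.
apply: continuous_FTC2 => //.
- apply: continuous_in_subspaceT => x; rewrite inE/= in_itv/= => /andP[ax _].
  by apply: cf; exact: lt_le_trans ax.
- split.
  + by move=> x; rewrite in_itv/= => /andP[ax _]; have [] := dF (lt_trans a0 ax).
  + by apply: cvg_at_right_filter; exact: cF.
  + by apply: cvg_at_left_filter; apply: cF; exact: lt_trans ab.
- move=> x; rewrite in_itv/= => /andP[ax _]; rewrite derive1E.
  by apply: derive_val; exact: dF (lt_trans a0 ax).
Qed.

Let integral_A n : (\int[mu]_(x in A n.+1) (f x)%:E =
  (F n.+2%:R)%:E - (F n.+2%:R^-1)%:E)%E.
Proof.
apply: pos_FTC2; first by rewrite invr_gt0.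
by rewrite (@lt_trans _ _ 1)// ?invf_lt1// ltr1n.
Qed.

Let bigcup_A : \bigcup_n A n.+1 = `]0, +oo[%classic.
Proof.
apply/seteqP; split => [x [n _]|x]; rewrite /A/= !in_itv/= andbT.
  by move=> /andP[+ _]; apply: lt_le_trans; rewrite invr_gt0.
move=> x0; exists (Num.truncn (x + x^-1)) => //=; rewrite in_itv/=.
have x'0 : 0 < x^-1 by rewrite invr_gt0.
have H : x + x^-1 <= (Num.truncn (x + x^-1)).+2%:R.
  by rewrite (le_trans (ltW (truncnS_gt _)))// ler_nat.
apply/andP; split; last by apply: le_trans H; rewrite lerDl ltW.
by rewrite invf_ple ?posrE//; apply: le_trans H; rewrite lerDr ltW.
Qed.

Let nd_A : nondecreasing_seq (fun n => A n.+1).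
Proof.
move=> m n mn; rewrite subsetEset => x; rewrite /A/= !in_itv/= => /andP[x1 x2].
rewrite (le_trans _ x1) ?(le_trans x2)// ?ler_nat//.
by rewrite lef_pV2 ?posrE// ler_nat.
Qed.

Let mf : measurable_fun (`]0%R, +oo[%classic : set R) f.
Proof.
apply: open_continuous_measurable_fun; first exact: interval_open.
by move=> x; rewrite inE/= in_itv/= andbT; exact: cf.
Qed.

Let subA n : A n.+1 `<=` `]0, +oo[.
Proof. by move=> x Ax; rewrite -bigcup_A; exists n. Qed.

(** On each [A n.+1] the integral is a difference of two values of [F], at most [2 * M]; a bounded
    primitive thus bounds the whole integral by monotone convergence. *)
Lemma pos_integral_le (M : R) : (forall x, 0 < x -> 0 <= f x) ->
  (forall x, 0 < x -> `|F x| <= M) ->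
  (\int[mu]_(x in `]0%R, +oo[) (f x)%:E <= (2 * M)%:E)%E.
Proof.
move=> f0 FM; rewrite -bigcup_A.
have mA n : measurable (A n.+1) by exact: measurable_itv.
have mfA n : measurable_fun (A n.+1) (EFin \o f).
  by apply/measurable_EFinP; apply: measurable_funS mf => //; exact: measurable_itv.
have f0A n x : A n.+1 x -> (0 <= (f x)%:E)%E.
  by move=> /subA /=; rewrite in_itv/= andbT lee_fin; exact: f0.
have /cvg_lim <- // := ge0_nondecreasing_set_cvg_integral (mu := mu) nd_A mA mfA f0A.
apply: lime_le.
  apply: ereal_nondecreasing_is_cvgn.
  by apply: ge0_nondecreasing_set_nondecreasing_integral => //; exact: f0A.
apply: nearW => n; rewrite integral_A -EFinB lee_fin.
have F1 := FM n.+2%:R (ltr0Sn _ _); have : 0 < n.+2%:R^-1 :> R by rewrite invr_gt0.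
move=> /FM F2; rewrite (le_trans (ler_norm _))// (le_trans (ler_normB _ _))//.
by rewrite mulr_natl mulr2n lerD.
Qed.

(** [f] may change sign, so the limit along the exhaustion is taken by dominated convergence with
    bound [|f|]. *)
Lemma pos_FTC2y (l0 l1 : R) :
  mu.-integrable (`]0%R, +oo[%classic : set R) (EFin \o f) ->
  F x @[x --> 0^'+] --> l0 -> F x @[x --> +oo] --> l1 ->
  (\int[mu]_(x in `]0%R, +oo[) (f x)%:E = (l1 - l0)%:E)%E.
Proof.
move=> intf F0 F1.
have mA n : measurable (A n.+1) by exact: measurable_itv.
have := @dominated_convergence _ _ _ mu (`]0%R, +oo[%classic : set R) (measurable_itv _)
    (fun n => (EFin \o f) \_ (A n.+1)) (EFin \o f) (abse \o (EFin \o f)).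
case.
- move=> n; apply/(measurable_restrict (EFin \o f) (mA n) (measurable_itv _)).
  by apply/measurable_EFinP; apply: measurable_funS mf => //; exact: measurable_itv.
- exact/measurable_EFinP.
- apply/aeW => x; rewrite -bigcup_A => -[m _ Amx].
  apply: cvg_near_cst; near=> n; rewrite patchE mem_set//.
  have mn : (m <= n)%N by near: n; exact: nbhs_infty_ge.
  by have /subsetPset := nd_A mn; exact.
- exact: integrable_abse.
- apply/aeW => x n _; rewrite patchE; case: ifPn => //= _.
  by rewrite normr0 lee_fin.
move=> _ _ H.
have E n : (\int[mu]_(x in `]0%R, +oo[) ((EFin \o f) \_ (A n.+1)) x =
    (F n.+2%:R - F n.+2%:R^-1)%:E)%E.
  rewrite -integral_mkcondr setIidr; last exact: subA.
  by rewrite integral_A EFinB.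
have {}H : (F n.+2%:R - F n.+2%:R^-1)%:E @[n --> \oo] -->
    (\int[mu]_(x in `]0%R, +oo[) (f x)%:E)%E.
  by rewrite -(funext E); exact: H.
have L1 : F n.+2%:R @[n --> \oo] --> l1.
  apply: (cvg_comp _ _ _ F1).
  exact: (cvg_comp _ _ (cvg_addnl 2) (@cvgr_idn R)).
have L0 : F n.+2%:R^-1 @[n --> \oo] --> l0.
  apply: (cvg_at_rightP F 0 l0).1 => //; split; first by move=> n; rewrite invr_gt0.
  exact: (cvg_comp _ _ (cvg_addnl 1) (@cvg_harmonic R)).
have L : (F n.+2%:R - F n.+2%:R^-1)%:E @[n --> \oo] --> (l1 - l0)%:E.
  by apply: cvg_EFin; [exact: nearW|exact: cvgB].
exact: (cvg_unique _ H L).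
Unshelve. all: by end_near. Qed.
End ftc.

(** If the integral vanished, [f] would be [0] almost everywhere and the half-line would be a null
    set. *)
Lemma pos_integral_gt0 (f : R -> R) : measurable_fun setT f ->
  (forall x, 0 < x -> 0 < f x) -> (0 < \int[mu]_(x in `]0%R, +oo[) (f x)%:E)%E.
Proof.
move=> mf f0; rewrite lt0e; apply/andP; split; last first.
  by apply: integral_ge0 => x /=; rewrite in_itv/= andbT lee_fin => /f0/ltW.
apply/eqP => H.
have : (\int[mu]_(x in `]0%R, +oo[) `|(f x)%:E| = 0)%E.
  rewrite -H; apply: eq_integral => x; rewrite inE/= in_itv/= andbT => /f0/ltW ?.
  by rewrite ger0_norm.
move=> /(ae_eq_integral_abs mu (measurable_itv _) _).1 => /(_ _)[].
  by apply/measurable_EFinP; exact: measurable_funTS.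
move=> N [mN N0 /= subN].
have : (mu `]0%R, +oo[%classic <= mu N)%E.
  apply: le_measure; rewrite ?inE//.
  move=> x x0; apply: subN => /(_ x0) [fx0].
  by move: x0; rewrite /= in_itv/= andbT => /f0; rewrite fx0 ltxx.
by rewrite N0 lebesgue_measure_itv/= ltry.
Qed.

(** The maximum is attained at [x = q / r]; the inequality [ln y <= y] at [y = r x / q] gives its
    value without the factor [e^(-q)]. *)
Lemma powR_expRN_le (q r x : R) : 0 < q -> 0 < r -> 0 < x ->
  x `^ q * expR (- (r * x)) <= (q / r) `^ q.
Proof.
move=> q0 r0 x0; have qr0 : 0 < q / r by rewrite divr_gt0.
rewrite /powR !gt_eqF// -expRD ler_expR lerBlDr.
have : ln x <= ln (q / r) + x / (q / r).
  have -> : ln x = ln (q / r) + ln (x / (q / r)).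
    by rewrite -lnM ?posrE ?divr_gt0// mulrC mulfVK// gt_eqF.
  by rewrite lerD2l ltW// ln_sublinear// divr_gt0.
move=> /(ler_wpM2l (ltW q0)) H; apply: le_trans H _.
rewrite mulrDr lerD2l le_eqVlt; apply/orP; left; apply/eqP; field.
by rewrite !gt_eqF.
Qed.

(** [(1 + u)^2 <= 2 + 2 u^2] and [y^(2a) e^(-y) <= (2a)^(2a)]. This compares the Gamma integrand
    with [x^(a-1) / (1 + x^a)^2], which has an explicit primitive. *)
Lemma powR_expRN_bounded (a y : R) : 0 < a -> 0 < y ->
  (1 + y `^ a) ^+ 2 * expR (- y) <= 2 + 2 * (2 * a) `^ (2 * a).
Proof.
move=> a0 y0; have := powR_expRN_le (mulr_gt0 (ltr0Sn R 1) a0) ltr01 y0.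
rewrite mul1r divr1 => H.
rewrite (_ : y `^ (2 * a) = (y `^ a) ^+ 2) in H; last first.
  by rewrite mulrC powRrM -powR_mulrn ?powR_ge0.
have e0 := expR_ge0 (- y); have e1 : expR (- y) <= 1.
  by rewrite -expR0 ler_expR oppr_le0 ltW.
move: H e0 e1; set u := y `^ a; set e := expR (- y); set v := _ `^ _ => H e0 e1.
have : (1 + u) ^+ 2 * e <= (2 + 2 * u ^+ 2) * e.
  by rewrite ler_wpM2r//; have := sqr_ge0 (1 - u); nra.
by move=> /le_trans; apply; rewrite mulrDl -mulrA; lra.
Qed.

Lemma continuous_powR_gt0 (a x : R) : 0 < x -> {for x, continuous (@powR R ^~ a)}.
Proof.
move=> x0; apply: differentiable_continuous; apply/derivable1_diffP.
by have [] : is_derive x 1 (@powR R ^~ a) (a * x `^ (a - 1)) by exact: is_derive1_powR.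
Qed.

Lemma powR_invl (x p : R) : 0 <= x -> (x^-1) `^ p = x `^ (- p).
Proof. by move=> x0; rewrite -powR_inv1// -powRrM mulN1r. Qed.

(* The integrand is the derivative of the bounded function [- e^-1 / (1 + x^e)];
   it dominates the Gamma integrand ([e = a]) and the inverse one ([e = - p]). *)
Lemma pos_integral_powR_le (e : R) : e != 0 ->
  (\int[mu]_(x in `]0%R, +oo[) (x `^ (e - 1) / (1 + x `^ e) ^+ 2)%:E <=
   (2 * `|e^-1|)%:E)%E.
Proof.
move=> e0.
have D0 (x : R) : 0 < 1 + x `^ e by rewrite ltr_wpDr// powR_ge0.
apply: (@pos_integral_le _ (fun x => - e^-1 * (1 + x `^ e)^-1)) => [x x0|x x0|x x0|x x0].
- apply: cvgM; first exact: continuous_powR_gt0.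
  apply: cvgV; first by rewrite expf_neq0// gt_eqF.
  apply: (@continuous_comp _ _ _ (fun x => 1 + x `^ e) (fun y => y ^+ 2)).
    by apply: cvgD; [exact: cvg_cst|exact: continuous_powR_gt0].
  exact: exprn_continuous.
- have Hp : is_derive x 1 (@powR R ^~ e) (e * x `^ (e - 1)) by exact: is_derive1_powR.
  have HV := is_deriveV (f := fun x => 1 + x `^ e) (lt0r_neq0 (D0 x))
    (is_deriveD (is_derive_cst (1 : R) x 1) Hp).
  apply: (is_derive_eq (is_deriveZ (- e^-1) HV)).
  rewrite add0r /GRing.scale/=; field.
  by rewrite e0 gt_eqF.
- by rewrite divr_ge0 ?sqr_ge0// powR_ge0.
- rewrite normrM normrN ler_piMr// ger0_norm; last by rewrite invr_ge0 ltW.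
  by rewrite invf_le1// lerDl powR_ge0.
Qed.

Lemma pos_integral_lty (g f : R -> R) (C : R) :
  measurable_fun setT g -> measurable_fun setT f ->
  (forall x, 0 < x -> 0 <= g x <= C * f x) -> 0 < C ->
  (\int[mu]_(x in `]0%R, +oo[) (f x)%:E < +oo ->
   \int[mu]_(x in `]0%R, +oo[) (g x)%:E < +oo)%E.
Proof.
move=> mg mf gf C0 foo.
have f0 x : 0 < x -> 0 <= f x.
  by move=> /gf/andP[g0 /(le_trans g0)]; rewrite pmulr_rge0.
apply: (@le_lt_trans _ _ (C%:E * \int[mu]_(x in `]0%R, +oo[) (f x)%:E)%E).
  rewrite -ge0_integralZl//; last 3 first.
  - by apply/measurable_EFinP; exact: measurable_funTS.
  - by move=> x /=; rewrite in_itv/= andbT lee_fin => /f0.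
  - by rewrite lee_fin ltW.
  apply: ge0_le_integral => //.
  - by move=> x /=; rewrite in_itv/= andbT lee_fin => /gf/andP[].
  - by apply/measurable_EFinP; exact: measurable_funTS.
  - by apply/measurable_EFinP; apply: measurable_funM => //; exact: measurable_funTS.
  - by move=> x /=; rewrite in_itv/= andbT lee_fin => /gf/andP[].
by rewrite lte_mul_pinfty// lee_fin ltW.
Qed.

Lemma measurable_powR_div (e : R) :
  measurable_fun [set: R] (fun x => x `^ (e - 1) / (1 + x `^ e) ^+ 2).
Proof.
apply: measurable_funM => //; apply: measurableT_comp measurable_invr _.
by apply: measurable_funX; exact: measurable_funD.
Qed.

Let bound_gt0 (a : R) : 0 < 2 + 2 * (2 * a) `^ (2 * a).
Proof. by rewrite ltr_wpDr// mulr_ge0// powR_ge0. Qed.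

Lemma pos_integral_gamma_lty (a : R) : 0 < a ->
  (\int[mu]_(x in `]0%R, +oo[) (x `^ (a - 1) * expR (- x))%:E < +oo)%E.
Proof.
move=> a0.
apply: (@pos_integral_lty _ (fun x => x `^ (a - 1) / (1 + x `^ a) ^+ 2)
  (2 + 2 * (2 * a) `^ (2 * a))) => //.
- by apply: measurable_funM => //; apply: measurableT_comp.
- exact: measurable_powR_div.
- move=> x x0; rewrite mulr_ge0 ?powR_ge0 ?expR_ge0//= mulrCA.
  rewrite ler_wpM2l ?powR_ge0// ler_pdivlMr; last first.
    by rewrite exprn_gt0// ltr_wpDr// powR_ge0.
  by rewrite mulrC powR_expRN_bounded.
- by rewrite (le_lt_trans (pos_integral_powR_le (lt0r_neq0 a0)))// ltry.
Qed.

Lemma pos_integral_invgamma_lty (p : R) : 0 < p ->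
  (\int[mu]_(x in `]0%R, +oo[) (x `^ (- p - 1) * expR (- x^-1))%:E < +oo)%E.
Proof.
move=> p0.
apply: (@pos_integral_lty _ (fun x => x `^ (- p - 1) / (1 + x `^ (- p)) ^+ 2)
  (2 + 2 * (2 * p) `^ (2 * p))) => //.
- apply: measurable_funM => //; apply: measurableT_comp => //.
  by apply: measurableT_comp => //; exact: measurable_invr.
- exact: measurable_powR_div.
- move=> x x0; rewrite mulr_ge0 ?powR_ge0 ?expR_ge0//= mulrCA.
  rewrite ler_wpM2l ?powR_ge0// ler_pdivlMr; last first.
    by rewrite exprn_gt0// ltr_wpDr// powR_ge0.
  (* The bound is taken at [y = x^-1], where [y^p = x^(-p)]. *)
  by rewrite mulrC -powR_invl ?(ltW x0)// powR_expRN_bounded// invr_gt0.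
- rewrite (le_lt_trans (pos_integral_powR_le _)) ?ltry//.
  by rewrite oppr_eq0 gt_eqF.
Qed.

Lemma Gamma_integral (a : R) : 0 < a ->
  (\int[mu]_(x in `]0%R, +oo[) (x `^ (a - 1) * expR (- x))%:E = (Gamma a)%:E)%E.
Proof.
move=> a0; rewrite fineK// ge0_fin_numE; first exact: pos_integral_gamma_lty.
by apply: integral_ge0 => x _; rewrite lee_fin mulr_ge0 ?powR_ge0 ?expR_ge0.
Qed.

Lemma Gamma_gt0 (a : R) : 0 < a -> 0 < Gamma a.
Proof.
move=> a0; rewrite -lte_fin -Gamma_integral//; apply: pos_integral_gt0.
  by apply: measurable_funM => //; apply: measurableT_comp.
by move=> x x0; rewrite mulr_gt0 ?powR_gt0 ?expR_gt0.
Qed.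

Lemma pos_integral_scale (c : R) (f : R -> R) : 0 < c -> measurable_fun setT f ->
  (forall x, 0 < x -> 0 <= f x) ->
  (\int[mu]_(x in `]0%R, +oo[) (f x)%:E =
   c%:E * \int[mu]_(x in `]0%R, +oo[) (f (c * x)%R)%:E)%E.
Proof.
move=> c0 mf f0; rewrite !integral_ifpos (@ge0_integral_scale _ c)//.
- by congr (_ * _)%E; apply: eq_integral => x _; rewrite pmulr_rgt0.
- by apply/measurable_EFinP; exact: measurable_ifpos.
- by move=> x; rewrite lee_fin; case: ifPn => // /f0.
Qed.

Lemma pos_integral_gamma (a r : R) : 0 < a -> 0 < r ->
  (\int[mu]_(x in `]0%R, +oo[) (x `^ (a - 1) * expR (- (r * x)))%:E =
   (Gamma a / r `^ a)%:E)%E.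
Proof.
move=> a0 r0.
have mg : measurable_fun [set: R] (fun x => x `^ (a - 1) * expR (- (r * x))).
  apply: measurable_funM => //; apply: measurableT_comp => //.
  by apply: measurableT_comp => //; exact: measurable_funM.
rewrite (pos_integral_scale (c := r^-1)) ?invr_gt0//; last first.
  by move=> x x0; rewrite mulr_ge0 ?powR_ge0 ?expR_ge0.
transitivity (r^-1%:E * ((r `^ (1 - a))%:E * (Gamma a)%:E))%E; last first.
  rewrite -!EFinM; congr EFin.
  rewrite powRB; last by rewrite (gt_eqF r0) implybT.
  rewrite powRr1 ?ltW//; field.
  by rewrite !gt_eqF// powR_gt0.
congr (_ * _)%E; rewrite -Gamma_integral// -ge0_integralZl//; last 3 first.
- apply/measurable_EFinP; apply: measurable_funTS.
  by apply: measurable_funM => //; apply: measurableT_comp.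
- by move=> x _; rewrite lee_fin mulr_ge0 ?powR_ge0 ?expR_ge0.
- by rewrite lee_fin powR_ge0.
apply: eq_integral => x; rewrite inE/= in_itv/= andbT => x0.
rewrite -EFinM mulVKf ?gt_eqF// powRM ?invr_ge0 ?ltW// powR_invl ?ltW// opprB.
by rewrite mulrA.
Qed.

(** The known value is [Gamma p], by substituting [x^-1]. An opaque positive number suffices, as
    total mass one fixes every normalization. *)
Definition invgamma_cst (p : R) : R :=
  fine (\int[mu]_(x in `]0%R, +oo[) (x `^ (- p - 1) * expR (- x^-1))%:E)%E.

Lemma invgamma_cst_integral (p : R) : 0 < p ->
  (\int[mu]_(x in `]0%R, +oo[) (x `^ (- p - 1) * expR (- x^-1))%:E =
   (invgamma_cst p)%:E)%E.
Proof.
move=> p0; rewrite fineK// ge0_fin_numE; first exact: pos_integral_invgamma_lty.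
by apply: integral_ge0 => x _; rewrite lee_fin mulr_ge0 ?powR_ge0 ?expR_ge0.
Qed.

Lemma measurable_invgamma (p k : R) :
  measurable_fun [set: R] (fun x => x `^ (- p - 1) * expR (- (k * x^-1))).
Proof.
apply: measurable_funM => //; apply: measurableT_comp => //.
by apply: measurableT_comp => //; apply: measurable_funM => //; exact: measurable_invr.
Qed.

Lemma invgamma_cst_gt0 (p : R) : 0 < p -> 0 < invgamma_cst p.
Proof.
move=> p0; rewrite -lte_fin -invgamma_cst_integral//; apply: pos_integral_gt0.
  by under eq_fun do rewrite -[X in expR (- X)]mul1r; exact: measurable_invgamma.
by move=> x x0; rewrite mulr_gt0 ?powR_gt0 ?expR_gt0.
Qed.

Lemma pos_integral_invgamma (p k : R) : 0 < p -> 0 < k ->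
  (\int[mu]_(x in `]0%R, +oo[) (x `^ (- p - 1) * expR (- (k * x^-1)))%:E =
   (invgamma_cst p / k `^ p)%:E)%E.
Proof.
move=> p0 k0.
rewrite (pos_integral_scale k0 (measurable_invgamma p k)); last first.
  by move=> x x0; rewrite mulr_ge0 ?powR_ge0 ?expR_ge0.
transitivity (k%:E * ((k `^ (- p - 1))%:E * (invgamma_cst p)%:E))%E; last first.
  rewrite -!EFinM; congr EFin.
  rewrite -opprD powRN powRD; last by rewrite (gt_eqF k0) implybT.
  rewrite powRr1 ?ltW//; field.
  by rewrite !gt_eqF// powR_gt0.
congr (_ * _)%E; rewrite -invgamma_cst_integral// -ge0_integralZl//; last 3 first.
- apply/measurable_EFinP; apply: measurable_funTS.
  by under eq_fun do rewrite -[X in expR (- X)]mul1r; exact: measurable_invgamma.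
- by move=> x _; rewrite lee_fin mulr_ge0 ?powR_ge0 ?expR_ge0.
- by rewrite lee_fin powR_ge0.
apply: eq_integral => x; rewrite inE/= in_itv/= andbT => x0.
rewrite -EFinM powRM ?ltW// invfM (mulrA k) mulfV ?gt_eqF// mul1r.
by rewrite mulrA.
Qed.
End half_line.

(** * Product formulas for [rho] *)

Section mixtures.
Context {R : realType}.
Notation mu := (@lebesgue_measure R).

Lemma set_inT (T U : Type) (h : T -> U) : [set y | h y \in [set: U]] = setT.
Proof. by apply/seteqP; split => // y _ /=; rewrite in_setT. Qed.

Lemma gt0_powRE (x y : R) : 0 < x -> x `^ y = expR (y * ln x).
Proof. by move=> x0; rewrite /powR gt_eqF. Qed.

(** [u z / c] is the value of the numerator for which [c] times the ratio equals [u], and [z / c] is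
    the Jacobian. All factors are positive, so the identity is checked on logarithms. *)
Lemma gamma_ratio_density (a b c u z : R) : 0 < c -> 0 < u -> 0 < z ->
  z `^ (b - 1) * expR (- z) * ((u * z / c) `^ (a - 1) * expR (- (u * z / c)) * (z / c)) =
  u `^ (a - 1) / c `^ a * (z `^ (a + b - 1) * expR (- ((1 + u / c) * z))).
Proof.
move=> c0 u0 z0; have uzc : 0 < u * z / c by rewrite divr_gt0// mulr_gt0.
have zc : 0 < z / c by rewrite divr_gt0.
rewrite -[X in _ * (_ * X) = _](@lnK _ (z / c)) ?posrE// !gt0_powRE// -expRN -!expRD.
congr expR; rewrite !lnM ?posrE ?mulr_gt0 ?invr_gt0// lnV ?posrE//; field.
by rewrite gt_eqF.
Qed.

Lemma invgamma_mul_density (a b k be u x : R) : 0 < be -> 0 < u -> 0 < x ->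
  x `^ (- b - 1) * expR (- (k * x^-1)) * ((u / x) `^ (a - 1) * expR (- (u / x / be)) / x) =
  u `^ (a - 1) * (x `^ (- (a + b) - 1) * expR (- ((k + u / be) * x^-1))).
Proof.
move=> be0 u0 x0; have ux : 0 < u / x by rewrite divr_gt0.
have x'0 : 0 < x^-1 by rewrite invr_gt0.
rewrite -[X in _ * (_ * X) = _](@lnK _ x^-1) ?posrE// !gt0_powRE// -!expRD.
congr expR; rewrite !lnM ?posrE ?mulr_gt0 ?invr_gt0// lnV ?posrE//; field.
by rewrite !gt_eqF.
Qed.

(** [mconv] integrates over its first factor, the gamma numerator, whereas the density computation
    conditions on the denominator. *)
Lemma dmeas_product_swap (f g : R -> R) (h : R * R -> R) (B : set R) :
  measurable_fun setT f -> (forall x, 0 <= f x) ->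
  measurable_fun setT g -> (forall x, 0 <= g x) ->
  measurable_fun setT h -> measurable B ->
  (\int[dmeas f]_x dmeas g [set y | h (x, y) \in B] =
   \int[dmeas g]_y dmeas f [set x | h (x, y) \in B])%E.
Proof.
move=> mf f0 mg g0 mh mB; rewrite (dmeas_product mf f0 mg g0 mh mB).
have mh' : measurable_fun setT (fun p : R * R => h (p.2, p.1)).
  by apply: measurableT_comp mh _; exact: measurable_fun_pair.
rewrite (dmeas_product mg g0 mf f0 mh' mB).
pose k (p : R * R) := (f p.1 * g p.2 * \1_B (h p))%:E.
have mk : measurable_fun [set: R * R] k.
  apply/measurable_EFinP; apply: measurable_funM.
    by apply: measurable_funM; exact: measurableT_comp.
  by apply: measurableT_comp mh; exact: measurable_indic.
have k0 p : (0 <= k p)%E by rewrite lee_fin !mulr_ge0.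
rewrite -[LHS]/(\int[mu]_x \int[mu]_y k (x, y))%E.
rewrite (@fubini_tonelli _ _ _ _ _ mu mu k mk k0).
by apply: eq_integral => y _; apply: eq_integral => x _; rewrite /k/= (mulrC (f x)).
Qed.

Lemma dmeas_scale_mixture_density (f g s w : R -> R) (C : R) (B : set R) :
  measurable_fun setT f -> (forall x, 0 <= f x) ->
  measurable_fun setT g -> (forall x, 0 <= g x) ->
  measurable_fun setT s -> (forall x, f x != 0 -> 0 < s x) ->
  (forall x, x <= 0 -> g x = 0) -> measurable B ->
  (forall u, 0 < u ->
    (\int[mu]_x (f x * (g (u / s x) / s x))%:E = (C * w u)%:E)%E) ->
  (\int[dmeas f]_x dmeas g [set y | (s x * y)%R \in B] =
   \int[mu]_(u in B) (if 0 < u then C * w u else 0)%:E)%E.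
Proof.
move=> mf f0 mg g0 ms fs gN mB fgw; rewrite dmeas_scale_mixture//.
apply: eq_integral => u _; case: ltP => u0; first exact: fgw.
apply: integral0_eq => x _; have [->|/fs sx] := eqVneq (f x) 0; first by rewrite mul0r.
by rewrite gN ?mul0r ?mulr0// pmulr_lle0// invr_gt0.
Qed.

(** Besides the normalization this yields finiteness of the integral of [w]; it is the source of the
    integrability of the Tricomi density. *)
Lemma normalized_dmeas (m : set R -> \bar R) (w : R -> R) (C : R) :
  measurable_fun setT w -> (forall x, 0 < x -> 0 <= w x) -> 0 < C ->
  (forall B, measurable B ->
    m B = (\int[mu]_(u in B) (if 0 < u then C * w u else 0)%:E)%E) ->
  m setT = 1%E ->
  (\int[mu]_(x in `]0%R, +oo[) (w x)%:E = (C^-1)%:E)%E /\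
  (forall B, measurable B -> m B =
    dmeas (fun x => if 0 < x then
      w x / fine (\int[mu]_(x in `]0%R, +oo[) (w x)%:E)%E else 0) B).
Proof.
move=> mw w0 C0 mE mT.
have Z : (\int[mu]_(x in `]0%R, +oo[) (w x)%:E = (C^-1)%:E)%E.
  move: mT; rewrite mE// -integral_ifpos.
  under eq_integral do rewrite EFinM.
  rewrite ge0_integralZl//; last 3 first.
  - by apply/measurable_EFinP; exact: measurable_funTS.
  - by move=> x /=; rewrite in_itv/= andbT lee_fin => /w0.
  - by rewrite lee_fin ltW.
  move=> H; rewrite -[LHS]mul1e -[X in (X * _)%E](_ : (C^-1)%:E * C%:E = 1)%E; last first.
    by rewrite -EFinM mulVf// gt_eqF.
  by rewrite -muleA H mule1.
split=> // B mB; rewrite Z/= mE// dmeasE.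
- by apply: eq_integral => u _; rewrite invrK; case: ifP => //; rewrite mulrC.
- by apply: measurable_ifpos; exact: measurable_funM.
- by move=> x; case: ifPn => // /w0 wx; rewrite mulr_ge0// !invrK ltW.
Qed.

Section gamma_pdf.
Variables a b : R.
Hypotheses (a0 : 0 < a) (b0 : 0 < b).

Lemma gamma_pdf_ge0 x : 0 <= gamma_pdf a b x.
Proof.
rewrite /gamma_pdf; case: ifPn => // _.
by rewrite divr_ge0 ?mulr_ge0 ?powR_ge0 ?expR_ge0// ltW// Gamma_gt0.
Qed.

Lemma gamma_pdf_le0 x : x <= 0 -> gamma_pdf a b x = 0.
Proof. by move=> x0; rewrite /gamma_pdf ltNge x0. Qed.

Lemma measurable_gamma_pdf : measurable_fun setT (gamma_pdf a b).
Proof.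
apply: measurable_ifpos; apply: measurable_funM => //; apply: measurable_funM => //.
apply: measurableT_comp => //; apply: measurableT_comp => //.
exact: measurable_funM.
Qed.

Lemma gamma_distT : gamma_dist a b setT = 1%E.
Proof.
rewrite /gamma_dist dmeasE; [|exact: measurable_gamma_pdf|exact: gamma_pdf_ge0].
rewrite -integral_ifpos.
have G0 := Gamma_gt0 a0; have p0 : 0 < b `^ a by rewrite powR_gt0.
transitivity ((b `^ a * Gamma a)^-1%:E *
    \int[mu]_(x in `]0%R, +oo[) (x `^ (a - 1) * expR (- (b^-1 * x)))%:E)%E.
  rewrite -ge0_integralZl//.
  - by apply: eq_integral => x _; rewrite -EFinM; congr EFin; rewrite [RHS]mulrC (mulrC b^-1).
  - apply/measurable_EFinP; apply: measurable_funTS; apply: measurable_funM => //.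
    by apply: measurableT_comp => //; apply: measurableT_comp.
  - by move=> x _; rewrite lee_fin mulr_ge0 ?powR_ge0 ?expR_ge0.
  - by rewrite lee_fin invr_ge0 mulr_ge0 ?ltW.
rewrite pos_integral_gamma ?invr_gt0// -EFinM; congr EFin.
rewrite powR_invl ?ltW// powRN; field.
by rewrite !gt_eqF.
Qed.
End gamma_pdf.

(** Up to constants the integrand in [z] is a gamma density of shape [a + b] and rate [1 + u / c],
    whose integral supplies the power of [u + c]. *)
Lemma gamma_ratio_kernel (a b c u : R) : 0 < a -> 0 < b -> 0 < c -> 0 < u ->
  (\int[mu]_z (gamma_pdf b 1 z * (gamma_pdf a 1 (u / (c / z)) / (c / z)))%:E =
   (Gamma (a + b) * c `^ b / (Gamma a * Gamma b) *
    (u `^ (a - 1) * (u + c) `^ (- (a + b))))%:E)%E.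
Proof.
move=> a0 b0 c0 u0; have ab0 : 0 < a + b by rewrite addr_gt0.
have ru : 0 < 1 + u / c by rewrite addr_gt0// divr_gt0.
rewrite /gamma_pdf; move: (Gamma_gt0 a0) (Gamma_gt0 b0) (pos_integral_gamma ab0 ru).
move: (Gamma a) (Gamma b) (Gamma (a + b)) => ga gb gab Ga Gb H.
pose K := u `^ (a - 1) / (c `^ a * (ga * gb)).
have K0 : 0 <= K by rewrite divr_ge0 ?mulr_ge0 ?powR_ge0// ltW.
transitivity (K%:E * \int[mu]_(z in `]0%R, +oo[)
    (z `^ (a + b - 1) * expR (- ((1 + u / c) * z)))%:E)%E.
  rewrite -ge0_integralZl//; last 2 first.
  - apply/measurable_EFinP; apply: measurable_funTS; apply: measurable_funM => //.
    by apply: measurableT_comp => //; apply: measurableT_comp.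
  - by move=> z _; rewrite lee_fin mulr_ge0 ?powR_ge0 ?expR_ge0.
  under [RHS]eq_integral do rewrite -EFinM.
  rewrite integral_ifpos; apply: eq_integral => z _; congr EFin.
  case: ltP => z0; last by rewrite mul0r.
  have -> : u / (c / z) = u * z / c by field; rewrite !gt_eqF.
  have cz : 0 < u * z / c by rewrite divr_gt0// mulr_gt0.
  rewrite cz /K !powR1 !mul1r !divr1.
  transitivity (z `^ (b - 1) * expR (- z) * ((u * z / c) `^ (a - 1) *
      expR (- (u * z / c)) * (z / c)) / (ga * gb)).
    by field; rewrite !gt_eqF.
  by rewrite gamma_ratio_density//; field; rewrite !gt_eqF// powR_gt0.
rewrite H -EFinM; congr EFin.
rewrite /K (_ : 1 + u / c = (u + c) / c); last first.
  by field; rewrite gt_eqF.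
have uc : 0 < u + c by rewrite addr_gt0.
rewrite powRM ?invr_ge0 ?ltW// (powR_invl _ (ltW c0)) !powRN.
rewrite (@powRD _ c a b); last by rewrite (gt_eqF c0) implybT.
field; rewrite !gt_eqF// powR_gt0//.
Qed.

(** Up to constants the integrand is an inverse gamma density of shape [a + b] and rate
    [k + u / be]; the relation [k * be = c] turns this rate into [(u + c) / be]. *)
Lemma invgamma_mul_kernel (a b k be c u : R) :
  0 < a -> 0 < b -> 0 < k -> 0 < be -> 0 < c -> k * be = c -> 0 < u ->
  (\int[mu]_x ((if 0 < x then x `^ (- b - 1) * expR (- (k * x^-1)) else 0) *
      (gamma_pdf a be (u / x) / x))%:E =
   (invgamma_cst (a + b) * be `^ b / Gamma a *
    (u `^ (a - 1) * (u + c) `^ (- (a + b))))%:E)%E.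
Proof.
move=> a0 b0 k0 be0 c0 kbe u0.
have ab0 : 0 < a + b by rewrite addr_gt0.
have ku : 0 < k + u / be by rewrite addr_gt0// divr_gt0.
rewrite /gamma_pdf; move: (Gamma_gt0 a0) (pos_integral_invgamma ab0 ku).
move: (Gamma a) (invgamma_cst (a + b)) => ga ig Ga H.
pose K := u `^ (a - 1) / (be `^ a * ga).
have K0 : 0 <= K by rewrite divr_ge0 ?mulr_ge0 ?powR_ge0// ltW.
transitivity (K%:E * \int[mu]_(x in `]0%R, +oo[)
    (x `^ (- (a + b) - 1) * expR (- ((k + u / be) * x^-1)))%:E)%E.
  rewrite -ge0_integralZl//; last 2 first.
  - by apply/measurable_EFinP; apply: measurable_funTS; exact: measurable_invgamma.
  - by move=> z _; rewrite lee_fin mulr_ge0 ?powR_ge0 ?expR_ge0.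
  under [RHS]eq_integral do rewrite -EFinM.
  rewrite integral_ifpos; apply: eq_integral => x _; congr EFin.
  case: ltP => x0; last by rewrite mul0r.
  have ux : 0 < u / x by rewrite divr_gt0.
  rewrite ux /K.
  transitivity (x `^ (- b - 1) * expR (- (k * x^-1)) *
      ((u / x) `^ (a - 1) * expR (- (u / x / be)) / x) / (be `^ a * ga)).
    by field; rewrite !gt_eqF// powR_gt0.
  by rewrite invgamma_mul_density//; field; rewrite !gt_eqF// powR_gt0.
rewrite H -EFinM; congr EFin.
rewrite /K (_ : k + u / be = (u + c) / be); last first.
  by rewrite -kbe; field; rewrite gt_eqF.
have uc : 0 < u + c by rewrite addr_gt0.
rewrite powRM ?invr_ge0 ?ltW// (powR_invl _ (ltW be0)) !powRN.
rewrite (@powRD _ be a b); last by rewrite (gt_eqF be0) implybT.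
field; rewrite !gt_eqF// powR_gt0//.
Qed.

(** * Densities and normalization of [rho] *)

Section rho_pdf.
Variables t th : R.
Hypotheses (t0 : 0 < t) (th0 : 0 < th).

(** Identifies [rho] at [lam = 1] as the inverse gamma law of shape [1 + t / th] and rate
    [t^2 / th]. *)
Lemma expR_Vpot1 x : 0 < x -> expR (- Vpot t th 1 x) =
  x `^ (- (1 + t / th) - 1) * expR (- (t ^+ 2 / th * x^-1)).
Proof.
move=> x0; rewrite /Vpot eqxx gt0_powRE// -expRD; congr expR.
by field; rewrite !gt_eqF.
Qed.

Lemma expR_Vpot lam x : 1 < lam -> 0 < x -> expR (- Vpot t th lam x) =
  x `^ (t / (th * (lam - 1)) - 1) *
  (x + t * (lam - 1)) `^ (- (t / (th * (lam - 1)) + (1 + t / th))).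
Proof.
move=> l1 x0; have l0 : 0 < lam - 1 by rewrite subr_gt0.
rewrite /Vpot gt_eqF// !gt0_powRE//; last by rewrite addr_gt0// mulr_gt0.
rewrite -expRD; congr expR; field.
by rewrite !gt_eqF.
Qed.

Lemma measurable_Vpot lam : measurable_fun setT (Vpot t th lam).
Proof.
rewrite /Vpot; case: (lam == 1).
  apply: measurable_funD; first exact: measurable_funM.
  apply: measurable_funM => //; apply: measurableT_comp; first exact: measurable_invr.
  exact: measurable_funM.
apply: measurable_funD; first exact: measurable_funM.
apply: measurable_funM => //; apply: measurableT_comp => //.
exact: measurable_funD.
Qed.

Lemma measurable_expR_Vpot lam : measurable_fun setT (fun x => expR (- Vpot t th lam x)).
Proof.
apply: measurableT_comp => //; apply: measurableT_comp => //.
exact: measurable_Vpot.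
Qed.

Lemma measurable_rho_pdf lam : measurable_fun setT (rho_pdf t th lam).
Proof.
by apply: measurable_ifpos; apply: measurable_funM => //; exact: measurable_expR_Vpot.
Qed.

Lemma rho_pdf_ge0 lam x : 0 <= rho_pdf t th lam x.
Proof.
rewrite /rho_pdf; case: ifPn => // _; rewrite divr_ge0 ?expR_ge0// fine_ge0//.
by apply: integral_ge0 => y _; rewrite lee_fin expR_ge0.
Qed.

Lemma Zpot1 : Zpot t th 1 =
  (invgamma_cst (1 + t / th) / (t ^+ 2 / th) `^ (1 + t / th))%:E.
Proof.
rewrite -pos_integral_invgamma; last 2 first.
- by rewrite addr_gt0// divr_gt0.
- by rewrite divr_gt0// exprn_gt0.
apply: eq_integral => x; rewrite inE/= in_itv/= andbT => x0.
by rewrite expR_Vpot1.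
Qed.

Lemma Zpot1_gt0 : 0 < fine (Zpot t th 1).
Proof.
rewrite Zpot1/= divr_gt0 ?powR_gt0 ?divr_gt0 ?exprn_gt0// invgamma_cst_gt0//.
by rewrite addr_gt0// divr_gt0.
Qed.

Lemma rho1T : rho t th 1 setT = 1%E.
Proof.
rewrite /rho dmeasE; [|exact: measurable_rho_pdf|exact: rho_pdf_ge0].
rewrite -integral_ifpos; have Z0 := Zpot1_gt0.
under eq_integral do rewrite EFinM.
rewrite ge0_integralZr//.
- rewrite -/(Zpot t th 1) -[X in (X * _)%E]fineK; last by rewrite Zpot1.
  by rewrite -EFinM mulfV// gt_eqF.
- apply/measurable_EFinP; apply: measurable_funTS; exact: measurable_expR_Vpot.
- by rewrite lee_fin invr_ge0 ltW.
Qed.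

Section lam_gt1.
Variable lam : R.
Hypothesis lam1 : 1 < lam.
Let l0 : 0 < lam - 1. Proof. by rewrite subr_gt0. Qed.
Let a := t / (th * (lam - 1)).
Let b := 1 + t / th.
Let c := t * (lam - 1).
Let a0 : 0 < a. Proof. by rewrite divr_gt0// mulr_gt0. Qed.
Let b0 : 0 < b. Proof. by rewrite addr_gt0// divr_gt0. Qed.
Let c0 : 0 < c. Proof. by rewrite mulr_gt0. Qed.
Let ab0 : 0 < a + b. Proof. by rewrite addr_gt0. Qed.

(** [C1^-1 = c^(-b) B(a, b)] with [B] the beta function: [rho] is a beta prime law scaled by [c]. *)
Let C1 := Gamma (a + b) * c `^ b / (Gamma a * Gamma b).

Lemma rho_gamma_ratio :
  Zpot t th lam = (C1^-1)%:E /\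
  (forall B, measurable B -> rho t th lam B =
    (\int[gamma_dist b 1]_z gamma_dist a 1 [set x | (c / z * x)%R \in B])%E).
Proof.
have m1E B : measurable B ->
    (\int[gamma_dist b 1]_z gamma_dist a 1 [set x | (c / z * x)%R \in B] =
     \int[mu]_(u in B) (if 0 < u then C1 * expR (- Vpot t th lam u) else 0)%:E)%E.
  move=> mB; apply: (@dmeas_scale_mixture_density _ _ (fun z => c / z)) => //.
  - exact: measurable_gamma_pdf.
  - exact: gamma_pdf_ge0.
  - exact: measurable_gamma_pdf.
  - exact: gamma_pdf_ge0.
  - by apply: measurable_funM => //; exact: measurable_invr.
  - move=> z /eqP gz; rewrite divr_gt0// ltNge; apply/negP => z0.
    by apply: gz; exact: gamma_pdf_le0.
  - by move=> x x0; exact: gamma_pdf_le0.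
  - by move=> u u0; rewrite gamma_ratio_kernel// expR_Vpot.
have C10 : 0 < C1.
  apply: divr_gt0; apply: mulr_gt0; [exact: Gamma_gt0|exact: powR_gt0| |];
    exact: Gamma_gt0.
have m1T : (\int[gamma_dist b 1]_z gamma_dist a 1 [set x | (c / z * x)%R \in setT] = 1)%E.
  under eq_integral do rewrite set_inT gamma_distT//.
  by rewrite integral_cst// mul1e; exact: gamma_distT.
have [Z rE] := normalized_dmeas (m := fun B =>
    (\int[gamma_dist b 1]_z gamma_dist a 1 [set x | (c / z * x)%R \in B])%E)
  (measurable_expR_Vpot lam) (fun x _ => expR_ge0 _) C10 m1E m1T.
by split => // B mB; rewrite rE.
Qed.

Let be := th * (lam - 1) / t.
Let be0 : 0 < be. Proof. by rewrite divr_gt0// mulr_gt0. Qed.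
Let Z1 := fine (Zpot t th 1).
Let C2 := invgamma_cst (a + b) * be `^ b / (Z1 * Gamma a).

Let kernel_rho1 u : 0 < u ->
  (\int[mu]_x (rho_pdf t th 1 x * (gamma_pdf a be (u / x) / x))%:E =
   (C2 * expR (- Vpot t th lam u))%:E)%E.
Proof.
move=> u0; have Z10 : 0 < Z1 := Zpot1_gt0.
have k0 : 0 < t ^+ 2 / th by rewrite divr_gt0// exprn_gt0.
(* The scale [be] is the one for which the rate [t^2 / th] of the inverse gamma law produces the
   shift [c]. *)
have kbe : t ^+ 2 / th * be = c by rewrite /be /c; field; rewrite !gt_eqF.
have H := invgamma_mul_kernel a0 b0 k0 be0 c0 kbe u0.
transitivity (Z1^-1%:E * (invgamma_cst (a + b) * be `^ b / Gamma a *
    (u `^ (a - 1) * (u + c) `^ (- (a + b))))%:E)%E; last first.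
  by rewrite -EFinM expR_Vpot// /C2 invfM; congr EFin; ring.
rewrite -H -ge0_integralZl//; last 3 first.
- apply/measurable_EFinP; apply: measurable_funM.
    by apply: measurable_ifpos; exact: measurable_invgamma.
  apply: measurable_funM; last exact: measurable_invr.
  apply: measurableT_comp; first exact: measurable_gamma_pdf.
  by apply: measurable_funM => //; exact: measurable_invr.
- move=> x _; rewrite lee_fin; case: ltP => x0; last by rewrite mul0r.
  by rewrite !mulr_ge0 ?powR_ge0 ?expR_ge0 ?gamma_pdf_ge0// invr_ge0 ltW.
- by rewrite lee_fin invr_ge0 ltW.
apply: eq_integral => x _; rewrite -EFinM; congr EFin; rewrite [RHS]mulrA; congr (_ * _).
rewrite /rho_pdf; case: ifPn => x0; last by rewrite mulr0.
by rewrite expR_Vpot1// mulrC.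
Qed.

Lemma rho_rho1_gamma B : measurable B ->
  (rho t th lam B = mconv (rho t th 1) (gamma_dist a be) B)%E.
Proof.
have m2E B' : measurable B' ->
    (mconv (rho t th 1) (gamma_dist a be) B' =
     \int[mu]_(u in B') (if 0 < u then C2 * expR (- Vpot t th lam u) else 0)%:E)%E.
  move=> mB; apply: (@dmeas_scale_mixture_density _ _ (fun x => x)) => //.
  - exact: measurable_rho_pdf.
  - exact: rho_pdf_ge0.
  - exact: measurable_gamma_pdf.
  - exact: gamma_pdf_ge0.
  - by move=> x; rewrite /rho_pdf; case: ifPn => //; rewrite eqxx.
  - by move=> x x0; exact: gamma_pdf_le0.
have C20 : 0 < C2.
  apply: divr_gt0; apply: mulr_gt0; [exact: invgamma_cst_gt0|exact: powR_gt0| |].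
    exact: Zpot1_gt0.
  exact: Gamma_gt0.
have m2T : mconv (rho t th 1) (gamma_dist a be) setT = 1%E.
  rewrite /mconv; under eq_integral do rewrite set_inT gamma_distT//.
  by rewrite integral_cst// mul1e; exact: rho1T.
have [Z rE] := normalized_dmeas (measurable_expR_Vpot lam) (fun x _ => expR_ge0 _)
  C20 m2E m2T.
by move=> mB; rewrite rE.
Qed.

Lemma rhoT : rho t th lam setT = 1%E.
Proof.
have [_ rE] := rho_gamma_ratio; rewrite (rE _ measurableT).
under eq_integral do rewrite set_inT gamma_distT//.
by rewrite integral_cst// mul1e; exact: gamma_distT.
Qed.

Lemma rho_Dil_gamma_ratio B : measurable B ->
  rho t th lam B = Dil c (mconv (gamma_dist a 1) (inv_meas (gamma_dist b 1))) B.
Proof.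
move=> mB; have [_ rE] := rho_gamma_ratio; rewrite (rE _ mB).
have mh : measurable_fun setT (fun p : R * R => c / p.2 * p.1).
  apply: measurable_funM => //; apply: measurable_funM => //.
  by apply: measurableT_comp; [exact: measurable_invr|exact: measurable_snd].
rewrite -(dmeas_product_swap (measurable_gamma_pdf a 1) (gamma_pdf_ge0 1 a0)
  (measurable_gamma_pdf b 1) (gamma_pdf_ge0 1 b0) mh mB).
rewrite /Dil /mconv /inv_meas; apply: eq_integral => x _; congr (dmeas _ _).
(* The convention [0^-1 = 0] makes inversion an involution of the whole line, so the image sets in
   [inv_meas] and [Dil] are preimages, with no exception at [0]. *)
apply/seteqP; split => [y /= yB|_ /= [y + <-]].
  exists y^-1; last by rewrite invrK.
  rewrite inE; exists (c / y * x); first exact: set_mem.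
  by move: (y^-1) => w; field; rewrite gt_eqF.
rewrite inE => -[v Bv vE]; rewrite invrK inE.
have -> : c * y * x = v by rewrite -mulrA (mulrC y) -vE mulrC divfK// gt_eqF.
by [].
Qed.
End lam_gt1.
End rho_pdf.
End mixtures.

(** * Kummer's equation and the logarithmic derivative *)

Lemma is_derive_expRM (R : realType) (k x : R) :
  is_derive x 1 (fun x => expR (k * x)) (k * expR (k * x)).
Proof.
have H : is_derive x 1 (k *: (id : R -> R)) (k *: 1) by exact: is_deriveZ.
have := is_derive1_comp (is_derive_expR (k * x)) H.
by rewrite /GRing.scale/= mulr1 mulrC.
Qed.

Lemma is_derive_continuous (R : realType) (f : R -> R) (x df : R) :
  is_derive x 1 f df -> {for x, continuous f}.
Proof.
by move=> [df' _]; apply: differentiable_continuous; exact/derivable1_diffP.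
Qed.

Lemma is_derive_powR_shift (R : realType) (c q x : R) : 0 < x + c ->
  is_derive x 1 (fun x => (x + c) `^ q) (q * (x + c) `^ (q - 1)).
Proof.
move=> xc; have H : is_derive x 1 (fun x => x + c) (1 + 0).
  exact: (is_deriveD (is_derive_id x 1) (is_derive_cst c x 1)).
have := @is_derive1_comp R (fun y => y `^ q) (fun x => x + c) x _ _ (is_derive1_powR q xc) H.
by rewrite addr0 mulr1.
Qed.

Lemma expRN_cvgy (R : realType) (k : R) : 0 < k ->
  expR (- (k * x)) @[x --> +oo] --> (0 : R).
Proof.
move=> k0; apply: (@cvg_comp _ _ _ (fun x => k * x) (fun z => expR (- z)) _
  (pinfty_nbhs R)); last exact: cvgr_expR.
exact: gt0_cvgMry.
Qed.

Section kummer.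
Context {R : realType}.
Notation mu := (@lebesgue_measure R).
Variables a b c : R.
Hypotheses (a0 : 0 < a) (b1 : 1 <= b) (c0 : 0 < c).

Let f (x : R) := x `^ (a - 1) * (x + c) `^ (- (a + b)).
Hypothesis f_lty : (\int[mu]_(x in `]0%R, +oo[) (f x)%:E < +oo)%E.

Let D : set R := `]0, +oo[%classic.
Let mD : measurable (D : set (measurableTypeR R)). Proof. exact: measurable_itv. Qed.

Let f_ge0 x : 0 <= f x. Proof. by rewrite mulr_ge0// powR_ge0. Qed.

Let mf : measurable_fun setT f.
Proof.
apply: measurable_funM => //.
apply: (@measurableT_comp _ _ _ _ _ _ (@powR R ^~ (- (a + b)))) => //.
exact: measurable_funD.
Qed.

Let integrable_f : mu.-integrable D (EFin \o f).
Proof.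
apply/integrableP; split; first by apply/measurable_EFinP; exact: measurable_funTS.
by under eq_integral do rewrite /= ger0_norm//.
Qed.

(** For [s > 0], [(-1)^j] times the [j]-th derivative of the Laplace transform of [f]; for [j = 0]
    it is [c^(-b) Gamma(a) U(a, 1 - b, c s)] with [U] Tricomi's function. *)
Definition kummer_integral (j : nat) (s : R) : R :=
  \int[mu]_(x in `]0%R, +oo[) (expR (- (s * x)) * (x ^+ j * f x)).
Let phi := kummer_integral.

Let expRX_le (j : nat) (s : R) : 0 < s ->
  exists2 C, 0 <= C & forall x, 0 < x -> expR (- (s * x)) * x ^+ j <= C.
Proof.
move=> s0; case: j => [|j].
  exists 1 => // x x0; rewrite expr0 mulr1 -expR0 ler_expR oppr_le0 mulr_ge0 ?ltW//.
exists ((j.+1%:R / s) `^ j.+1%:R); first exact: powR_ge0.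
move=> x x0; rewrite mulrC -powR_mulrn; last exact: ltW.
exact: powR_expRN_le.
Qed.

Lemma measurable_kummer j (s : R) :
  measurable_fun setT (fun x : R => expR (- (s * x)) * (x ^+ j * f x)).
Proof.
apply: measurable_funM.
  by apply: measurableT_comp => //; apply: measurableT_comp.
by apply: measurable_funM => //; exact: measurable_funX.
Qed.

Let integrable_Cf C : mu.-integrable D (EFin \o (fun x => C * f x)).
Proof.
exact: (integrableZl mD C integrable_f).
Qed.

Let integrable_kummer j (s : R) : 0 < s ->
  mu.-integrable D (EFin \o (fun x : R => expR (- (s * x)) * (x ^+ j * f x))).
Proof.
move=> s0; have [C C0 HC] := expRX_le j s0.
apply: (le_integrable mD _ _ (integrable_Cf C)).
- by apply/measurable_EFinP; apply: measurable_funTS; exact: measurable_kummer.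
- move=> x; rewrite /D/= in_itv/= andbT => x0.
  rewrite lee_fin !ger0_norm.
  + by rewrite mulrA ler_wpM2r// HC.
  + by rewrite mulr_ge0.
  + by rewrite mulr_ge0 ?expR_ge0// mulr_ge0// exprn_ge0// ltW.
Qed.

Let integrable_kummer0 : mu.-integrable D
  (EFin \o (fun x : R => expR (- (0 * x)) * (x ^+ 0 * f x))).
Proof.
apply: (eq_integrable mD _ _ _ integrable_f) => x _ /=.
by rewrite mul0r oppr0 expR0 expr0 !mul1r.
Qed.

(** [x^j f] decays like [x^(j - 1 - b)], so moments of order at least [b] diverge; at [s = 0] only
    [j = 0] is kept. *)
Lemma kummer_integralE j (s : R) : (0 < s) || ((s == 0) && (j == 0%N)) ->
  (\int[mu]_(x in `]0%R, +oo[) (expR (- (s * x)) * (x ^+ j * f x))%:E =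
   (phi j s)%:E)%E.
Proof.
move=> H; rewrite fineK//; apply: integrable_fin_num => //.
move: H => /orP[s0|/andP[/eqP -> /eqP ->]]; first exact: integrable_kummer.
exact: integrable_kummer0.
Qed.

Lemma kummer_integral_gt0 j (s : R) : (0 < s) || ((s == 0) && (j == 0%N)) -> 0 < phi j s.
Proof.
move=> H; rewrite -lte_fin -kummer_integralE//; apply: pos_integral_gt0.
  exact: measurable_kummer.
move=> x x0; rewrite mulr_gt0 ?expR_gt0// mulr_gt0 ?exprn_gt0//.
by rewrite mulr_gt0 ?powR_gt0// addr_gt0.
Qed.

Lemma is_derive_kummer_integral j (s : R) : 0 < s ->
  is_derive s 1 (phi j) (- phi j.+1 s).
Proof.
move=> s0; have s20 : 0 < s / 2 by rewrite divr_gt0.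
have [C C0 HC] := expRX_le j.+1 s20.
pose g (x y : R) := expR (- (x * y)) * (y ^+ j * f y).
have Dg (x y : R) : is_derive x 1 (g ^~ y) (- (expR (- (x * y)) * (y ^+ j.+1 * f y))).
  have := is_derive_expRM (- y) x => Hd.
  have Hg := is_deriveZ (y ^+ j * f y) Hd.
  rewrite (_ : g ^~ y = (y ^+ j * f y) *: (fun x => expR (- y * x))); last first.
    by apply/funext => z; rewrite /g /GRing.scale/= mulrC mulNr (mulrC y).
  apply: is_derive_eq; rewrite /GRing.scale/= !mulNr (mulrC y x) exprS; ring.
(* On this neighbourhood the exponential is at most its value at rate [s / 2], so [C * f], with [C]
   taken at that rate, dominates the derivative uniformly. *)
have Is : (`]s / 2, s + 1[%classic : set R) s.
  by rewrite /= in_itv/=; lra.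
have intg (x : R) : (`]s / 2, s + 1[%classic : set R) x -> mu.-integrable D (EFin \o g x).
  by rewrite /= in_itv/= => /andP[x0 _]; apply: integrable_kummer; lra.
have derg (x y : R) : (`]s / 2, s + 1[%classic : set R) x -> D y -> derivable (g ^~ y) x 1.
  by move=> _ _; case: (Dg x y).
have G0 y : 0 <= C * f y by rewrite mulr_ge0.
have intG : mu.-integrable D (EFin \o (fun y => C * f y)).
  exact: integrable_Cf.
have d1gE x y : partial1of2 g x y = - (expR (- (x * y)) * (y ^+ j.+1 * f y)).
  by rewrite partial1of2E; apply: derive_val; exact: Dg.
have Gub (x y : R) : (`]s / 2, s + 1[%classic : set R) x -> D y -> `|partial1of2 g x y| <= C * f y.
  rewrite /D/= !in_itv/= andbT => /andP[x0 _] y0; rewrite d1gE normrN ger0_norm; last first.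
    by rewrite mulr_ge0 ?expR_ge0// mulr_ge0// exprn_ge0// ltW.
  rewrite mulrA ler_wpM2r//; apply: le_trans (HC _ y0).
  by rewrite ler_wpM2r ?exprn_ge0 ?(ltW y0)// ler_expR lerN2 ler_wpM2r// ltW.
have d1 := derivable_under_integral mD Is intg derg G0 intG Gub.
have d2 := differentiation_under_integral mD Is intg derg G0 intG Gub.
apply: DeriveDef => //; rewrite -derive1E.
rewrite [LHS]d2 -[RHS]mulN1r -RintegralZl//; last exact: integrable_kummer.
by apply: eq_Rintegral => y _; rewrite d1gE mulN1r.
Qed.

Let continuous_expRN (k x : R) : {for x, continuous (fun x => expR (- (k * x)))}.
Proof.
have -> : (fun x => expR (- (k * x))) = (fun x => expR (- k * x)).
  by apply/funext => y; rewrite mulNr.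
exact: (is_derive_continuous (is_derive_expRM (- k) x)).
Qed.

Let continuous_powR_shift (q x : R) : 0 < x + c ->
  {for x, continuous (fun x => (x + c) `^ q)}.
Proof.
by move=> xc; exact: (is_derive_continuous (is_derive_powR_shift q xc)).
Qed.

Let continuous_f x : 0 < x -> {for x, continuous f}.
Proof.
move=> x0; apply: cvgM; first exact: continuous_powR_gt0.
by apply: continuous_powR_shift; rewrite addr_gt0.
Qed.

(** [g] is the derivative of [G], which vanishes at both ends of the half-line. As [g] is
    [e^(-s x) f] times a quadratic polynomial, its zero integral is a relation between [phi 2],
    [phi 1] and [phi 0], that is, Kummer's equation. *)
Let g (s x : R) := expR (- (s * x)) * ((s * x ^+ 2 + (s * c + b - 1) * x - a * c) * f x).
Let G (s x : R) := - (expR (- (s * x)) * (x `^ a * (x + c) `^ (1 - (a + b)))).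

Let gE s : g s = fun x => s * (expR (- (s * x)) * (x ^+ 2 * f x)) +
  (s * c + b - 1) * (expR (- (s * x)) * (x ^+ 1 * f x)) -
  a * c * (expR (- (s * x)) * (x ^+ 0 * f x)).
Proof. by apply/funext => x; rewrite /g expr0 expr1; ring. Qed.

Let integrable_Z j (s k : R) : 0 < s ->
  mu.-integrable D (EFin \o (fun x : R => k * (expR (- (s * x)) * (x ^+ j * f x)))).
Proof. by move=> s0; exact: (integrableZl mD k (integrable_kummer j s0)). Qed.

Let integrable_ZD (s k1 k2 : R) : 0 < s ->
  mu.-integrable D (EFin \o (fun x : R => k1 * (expR (- (s * x)) * (x ^+ 2 * f x)) +
    k2 * (expR (- (s * x)) * (x ^+ 1 * f x)))).
Proof.
by move=> s0; exact: (integrableD mD (integrable_Z 2 k1 s0) (integrable_Z 1 k2 s0)).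
Qed.

Let integrable_g s : 0 < s -> mu.-integrable D (EFin \o g s).
Proof.
move=> s0; rewrite gE.
exact: (integrableB mD (integrable_ZD _ _ s0) (integrable_Z 0 (a * c) s0)).
Qed.

Let is_derive_G (s x : R) : 0 < x -> is_derive x 1 (G s) (g s x).
Proof.
move=> x0; have xc : 0 < x + c by rewrite addr_gt0.
have H1 := is_derive_expRM (- s) x.
have H2 : is_derive x 1 (@powR R ^~ a) (a * x `^ (a - 1)) by exact: is_derive1_powR.
have H3 := is_derive_powR_shift (1 - (a + b)) xc.
have := is_deriveN (is_deriveM H1 (is_deriveM H2 H3)).
rewrite (_ : - _ = G s); last first.
  by apply/funext => y; rewrite /G !fctE mulNr.
move=> H; apply: (is_derive_eq H); rewrite /GRing.scale/= !fctE /g /f.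
rewrite -!(mulr_powRB1 (ltW x0) a0) (_ : 1 - (a + b) - 1 = - (a + b)); last by ring.
rewrite (@powRD _ (x + c)); last by rewrite (gt_eqF xc) implybT.
by rewrite powRr1 ?(ltW xc)// -mulNr; ring.
Qed.

Let G_cvg0 (s : R) : G s x @[x --> 0^'+] --> (0 : R).
Proof.
have H : expR (- (s * x)) * (x `^ a * (x + c) `^ (1 - (a + b))) @[x --> (0:R)^'+] -->
    expR (- (s * 0)) * (0 * (0 + c) `^ (1 - (a + b))).
  apply: cvgM; first by apply: cvg_at_right_filter; exact: continuous_expRN.
  apply: cvgM; first exact: powR_cvg0.
  by apply: cvg_at_right_filter; apply: continuous_powR_shift; rewrite add0r.
have := cvgN H; rewrite mul0r mulr0 oppr0 => H1; exact: H1.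
Qed.

Let G_cvgy (s : R) : 0 < s -> G s x @[x --> +oo] --> (0 : R).
Proof.
move=> s0; have s20 : 0 < s / 2 by rewrite divr_gt0.
(* Half of the exponential absorbs [x^a]. The exponent [1 - (a + b)] is nonpositive because
   [b >= 1], so the shifted power is largest at [x = 0]. *)
pose K := (a / (s / 2)) `^ a * c `^ (1 - (a + b)).
have K0 : 0 <= K by rewrite mulr_ge0 ?powR_ge0.
apply: (@squeeze_cvgr _ _ _ _ (fun x => - (K * expR (- (s / 2 * x)))) (fun=> 0)).
- near=> x; have x0 : 0 < x by near: x; exact: nbhs_pinfty_gt.
  have xc : 0 < x + c by rewrite addr_gt0.
  rewrite /G lerN2 oppr_le0 mulr_ge0 ?expR_ge0 ?mulr_ge0 ?powR_ge0// andbT.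
  rewrite (_ : - (s * x) = - (s / 2 * x) - s / 2 * x); last by field.
  rewrite expRD mulrC mulrA ler_wpM2r ?expR_ge0// mulrAC /K ler_pM ?powR_ge0//.
  + by rewrite mulr_ge0 ?powR_ge0 ?expR_ge0.
  + exact: powR_expRN_le.
  rewrite -opprB !powRN lef_pV2 ?posrE ?powR_gt0//.
  apply: ge0_ler_powR; rewrite ?nnegrE ?(ltW c0) ?(ltW xc)//.
    by rewrite subr_ge0 ler_wpDl// ltW.
  by rewrite lerDr ltW.
- have : K * expR (- (s / 2 * x)) @[x --> +oo] --> K * 0.
    by apply: cvgMr; exact: expRN_cvgy.
  by move=> /cvgN; rewrite mulr0 oppr0 => H1; exact: H1.
- exact: cvg_cst.
Unshelve. all: by end_near. Qed.

Lemma kummer_relation (s : R) : 0 < s ->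
  s * phi 2 s + (s * c + b - 1) * phi 1 s = a * c * phi 0 s.
Proof.
move=> s0.
have cg (x : R) : 0 < x -> {for x, continuous (g s)}.
  move=> x0; apply: cvgM; first exact: continuous_expRN.
  apply: cvgM; last exact: continuous_f.
  apply: cvgB; last exact: cvg_cst.
  apply: cvgD; first by apply: cvgMr; exact: exprn_continuous.
  by apply: cvgMr; exact: cvg_id.
have := pos_FTC2y cg (@is_derive_G s) (integrable_g s0) (G_cvg0 s) (G_cvgy s0).
rewrite subrr => /(congr1 fine)/=; rewrite -/(Rintegral mu D (g s)) gE.
rewrite RintegralB//; [|exact: integrable_ZD|exact: integrable_Z].
rewrite RintegralD//; [|exact: integrable_Z|exact: integrable_Z].
rewrite !RintegralZl//; [|exact: integrable_kummer..].
by move/eqP; rewrite subr_eq0 => /eqP.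
Qed.
End kummer.

(** * Primitives up to infinity and the Pareto kernel *)

Section fixpoint_kernel.
Context {R : realType}.
Notation mu := (@lebesgue_measure R).

Lemma pos_integral_FTC2y (g G : R -> R) (l : R) :
  (forall x, 0 <= x -> 0 <= g x) ->
  (forall x : R, 0 <= x -> {for x, continuous g}) ->
  (forall x : R, 0 <= x -> is_derive x 1 G (g x)) ->
  G x @[x --> +oo] --> l ->
  (\int[mu]_(x in `]0%R, +oo[) (g x)%:E = l%:E - (G 0)%:E)%E.
Proof.
move=> g0 cg dG Gl.
have cg' : {within `[0%R, +oo[, continuous g}.
  by apply: continuous_in_subspaceT => x; rewrite inE/= in_itv/= andbT; exact: cg.
have mg : measurable_fun (`]0%R, +oo[%classic : set R) g.
  apply: open_continuous_measurable_fun; first exact: interval_open.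
  by move=> x; rewrite inE/= in_itv/= andbT => /ltW; exact: cg.
rewrite integral_itv_obnd_cbnd; last exact/measurable_EFinP.
apply: ge0_continuous_FTC2y => //.
- by move=> x /ltW x0; case: (dG x x0).
- apply: cvg_at_right_filter; exact: (is_derive_continuous (dG 0 (lexx _))).
- move=> x; rewrite in_itv/= andbT => /ltW x0; rewrite derive1E.
  by apply: derive_val; exact: dG.
Qed.

Lemma powR_shift_cvgy (d : R) : 0 < d -> (x + 1) `^ (- d) @[x --> +oo] --> (0 : R).
Proof.
move=> d0; apply/cvgrPdist_lt => e e0; near=> x.
have x0 : 0 < x by near: x; exact: nbhs_pinfty_gt.
have xe : (e^-1) `^ d^-1 < x + 1.
  by rewrite ltr_wpDr//; near: x; exact: nbhs_pinfty_gt.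
rewrite sub0r normrN ger0_norm ?powR_ge0// powRN invf_plt ?posrE ?powR_gt0 ?addr_gt0//.
rewrite -[ltLHS]powRr1 ?invr_ge0 ?(ltW e0)//.
rewrite -[X in _ `^ X < _](mulVf (lt0r_neq0 d0)) powRrM.
by apply: gt0_ltr_powR => //; rewrite nnegrE ?powR_ge0// ltW// addr_gt0.
Unshelve. all: by end_near. Qed.

(** Left unnormalized, with mass [d^-1]: at [d = 2a + b] it is the kernel of the fixed-point
    equation. *)
Definition pareto_pdf (d x : R) : R := if 0 < x then (x + 1) `^ (- d - 1) else 0.

Lemma pareto_pdf_ge0 d x : 0 <= pareto_pdf d x.
Proof. by rewrite /pareto_pdf; case: ifPn => // _; exact: powR_ge0. Qed.

Lemma measurable_pareto_pdf d : measurable_fun setT (pareto_pdf d).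
Proof.
apply: measurable_ifpos.
apply: (@measurableT_comp _ _ _ _ _ _ (@powR R ^~ (- d - 1))) => //.
exact: measurable_funD.
Qed.

Lemma integral_pareto_pdf (d : R) (h : R -> R) :
  measurable_fun setT h -> (forall x, 0 <= h x) ->
  (\int[dmeas (pareto_pdf d)]_x (h x)%:E =
   \int[mu]_(x in `]0%R, +oo[) (h x * (x + 1) `^ (- d - 1))%:E)%E.
Proof.
move=> mh h0.
rewrite (integral_dmeas (measurable_pareto_pdf d) (pareto_pdf_ge0 d)); last 2 first.
- exact/measurable_EFinP.
- by move=> x; rewrite lee_fin.
rewrite integral_ifpos; apply: eq_integral => x _; rewrite -EFinM /pareto_pdf.
by case: ifPn => // _; rewrite mulr0.
Qed.

Lemma pareto_mass (d : R) : 0 < d -> dmeas (pareto_pdf d) setT = (d^-1)%:E.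
Proof.
move=> d0; rewrite -[LHS]mul1e -integral_cst//.
rewrite (_ : cst 1%E = fun x : R => (1 : R)%:E)// integral_pareto_pdf//.
have x1 (x : R) : 0 <= x -> 0 < x + 1 by move=> x0; rewrite ltr_wpDl.
under eq_integral do rewrite mul1r.
have g0 (x : R) : 0 <= x -> 0 <= (x + 1) `^ (- d - 1) by rewrite powR_ge0.
have cg (x : R) : 0 <= x -> {for x, continuous (fun x : R => (x + 1) `^ (- d - 1))}.
  by move=> x0; exact: (is_derive_continuous (is_derive_powR_shift (- d - 1) (x1 _ x0))).
have dG (x : R) : 0 <= x ->
    is_derive x 1 (fun x : R => - d^-1 * (x + 1) `^ (- d)) ((x + 1) `^ (- d - 1)).
  move=> x0; have H := is_deriveZ (- d^-1) (is_derive_powR_shift (- d) (x1 _ x0)).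
  by apply: (is_derive_eq H); rewrite /GRing.scale/= mulrA mulrNN mulVf ?mul1r// gt_eqF.
have Gl : (fun x : R => - d^-1 * (x + 1) `^ (- d)) x @[x --> +oo] --> - d^-1 * 0.
  by apply: cvgMr; exact: powR_shift_cvgy.
rewrite (pos_integral_FTC2y g0 cg dG Gl).
by rewrite /= mulr0 !add0r powR1 mulr1 opprK.
Qed.
End fixpoint_kernel.

(** * Riccati and fixed-point equations for the logarithmic derivative *)

Section log_derivative.
Context {R : realType}.
Notation mu := (@lebesgue_measure R).
Variables a b c : R.
Hypotheses (a0 : 0 < a) (b1 : 1 <= b) (c0 : 0 < c).
Hypothesis f_lty : (\int[mu]_(x in `]0%R, +oo[)
  (x `^ (a - 1) * (x + c) `^ (- (a + b)))%:E < +oo)%E.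
Let phi := kummer_integral a b c.
Let D := 2 * a + b.
Let b0 : 0 < b. Proof. by apply: lt_le_trans b1. Qed.
Let D0 : 0 < D. Proof. by rewrite addr_gt0// mulr_gt0. Qed.

Let phi0_gt0 (s : R) : 0 <= s -> 0 < phi 0 s.
Proof.
move=> s0; apply: kummer_integral_gt0 => //.
by rewrite andbT orbC eq_sym -le_eqVlt.
Qed.

Definition kummer_elasticity (s : R) : R := a - s * phi 1 s / phi 0 s.
Let W := kummer_elasticity.

(** The factor [s = 0] removes the first moment, which may be infinite. *)
Let W0 : W 0 = a. Proof. by rewrite /W /kummer_elasticity !mul0r subr0. Qed.

Let phi_gt0 j (s : R) : 0 < s -> 0 < phi j s.
Proof. by move=> s0; apply: kummer_integral_gt0 => //; rewrite s0. Qed.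

Lemma kummer_elasticity_bounds (s : R) : 0 <= s -> 0 <= W s <= a.
Proof.
rewrite le_eqVlt => /orP[/eqP <-|s0]; first by rewrite W0 lexx ltW.
have p0 := phi_gt0 0 s0; have p1 := phi_gt0 1 s0; have p2 := phi_gt0 2 s0.
have K := kummer_relation a0 b1 c0 f_lty s0.
rewrite /W /kummer_elasticity subr_ge0 ler_pdivrMr// gerBl.
rewrite divr_ge0 ?mulr_ge0 ?(ltW p1) ?(ltW s0) ?(ltW p0)// andbT.
have h1 : 0 <= (b - 1) * phi 1 s by rewrite mulr_ge0 ?subr_ge0// ltW.
have h2 : 0 <= s * phi 2 s by rewrite mulr_ge0// ltW.
(* Kummer's relation gives [c (a phi 0 - s phi 1) = s phi 2 + (b - 1) phi 1], which is nonnegative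
   since [b >= 1]. *)
rewrite -(ler_pM2l c0) -subr_ge0; rewrite -/phi in K.
rewrite (_ : _ - _ = s * phi 2 s + (b - 1) * phi 1 s) ?addr_ge0//.
by rewrite mulrA (mulrC c a) -K; ring.
Qed.

(** The Riccati right-hand side in terms of [a - W s = s phi 1 / phi 0]; expanded, its numerator is
    [(D + c s) W - a (a + b) - W^2]. *)
Let dW (s : R) := (a * c * s - (a - W s) ^+ 2 - (s * c + b) * (a - W s)) / s.

Lemma is_derive_kummer_elasticity (s : R) : 0 < s -> is_derive s 1 W (dW s).
Proof.
move=> s0; have p0 := phi_gt0 0 s0.
have d0 := is_derive_kummer_integral f_lty 0 s0.
have d1 := is_derive_kummer_integral f_lty 1 s0.
have K := kummer_relation a0 b1 c0 f_lty s0.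
have dV := is_deriveV (lt0r_neq0 p0) d0.
have H := is_deriveB (is_derive_cst a s 1) (is_deriveM (is_deriveM (is_derive_id s 1) d1) dV).
apply: (is_derive_eq H); rewrite !fctE /GRing.scale/= /dW /W /kummer_elasticity.
rewrite -/phi in K *.
have E : phi 2 s = (a * c * phi 0 s - (s * c + b - 1) * phi 1 s) / s.
  by rewrite -K; field; exact: lt0r_neq0.
rewrite E; field; rewrite !gt_eqF//.
Qed.

Lemma kummer_elasticity_fixpoint (s : R) : 0 <= s ->
  (\int[mu]_(z in `]0%R, +oo[) (expR (- (s * (c * z))) *
     (a * (a + b) + W (s * (1 + z)) ^+ 2) * (z + 1) `^ (- D - 1))%:E = (W s)%:E)%E.
Proof.
have z1 (z : R) : 0 <= z -> 0 < z + 1 by move=> z0; rewrite ltr_wpDl.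
(* [W] is differentiated at positive points only; at [s = 0] the equation is the identity
   [a (a + b) + a^2 = a D]. *)
rewrite le_eqVlt => /orP[/eqP <-|s0].
  rewrite -(@integral_pareto_pdf _ D (fun z => expR (- (0 * (c * z))) *
    (a * (a + b) + W (0 * (1 + z)) ^+ 2))); last 2 first.
  - under eq_fun do rewrite !mul0r W0; exact: measurable_cst.
  - move=> z; rewrite !mul0r W0 mulr_ge0 ?expR_ge0// addr_ge0 ?sqr_ge0//.
    by rewrite mulr_ge0 ?addr_ge0// ltW.
  under eq_integral do rewrite !mul0r W0 oppr0 expR0 mul1r.
  rewrite integral_cst// [X in (_ * X)%E](pareto_mass D0) W0 -EFinM; congr EFin.
  by rewrite /D; field; rewrite gt_eqF.
(* [- G] is [W] times its integrating factor in the variable [s (z + 1)], normalized to equal [W s]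
   at [z = 0]. By the Riccati equation the derivative of [G] is the integrand. *)
pose G (z : R) := - (W (s * (z + 1)) * (expR (- (s * c) * z) * (z + 1) `^ (- D))).
have sz (z : R) : 0 <= z -> 0 < s * (z + 1) by move=> z0; rewrite mulr_gt0// z1.
have inner (z : R) : is_derive z 1 (fun z : R => s * (z + 1)) s.
  have H := is_deriveZ s (is_deriveD (is_derive_id z 1) (is_derive_cst (1 : R) z 1)).
  by apply: (is_derive_eq H); rewrite /GRing.scale/= addr0 mulr1.
have dWs (z : R) : 0 <= z -> is_derive z 1 (fun z : R => W (s * (z + 1))) (dW (s * (z + 1)) * s).
  move=> z0.
  exact: (@is_derive1_comp R W (fun z : R => s * (z + 1)) z _ _
    (is_derive_kummer_elasticity (sz _ z0)) (inner z)).
pose g (z : R) := expR (- (s * (c * z))) * (a * (a + b) + W (s * (1 + z)) ^+ 2) *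
  (z + 1) `^ (- D - 1).
have g0 (z : R) : 0 <= z -> 0 <= g z.
  move=> z0; rewrite mulr_ge0 ?powR_ge0// mulr_ge0 ?expR_ge0//.
  by rewrite addr_ge0 ?sqr_ge0// mulr_ge0 ?addr_ge0// ltW.
have cg (z : R) : 0 <= z -> {for z, continuous g}.
  move=> z0; apply: cvgM; last first.
    exact: (is_derive_continuous (is_derive_powR_shift (- D - 1) (z1 _ z0))).
  apply: cvgM.
    have H : {for z, continuous (fun z : R => expR (- (s * (c * z))))}.
      rewrite (_ : (fun z => expR _) = fun z => expR (- (s * c) * z)); last first.
        by apply/funext => y; rewrite mulrA mulNr.
      exact: (is_derive_continuous (is_derive_expRM (- (s * c)) z)).
    exact: H.
  apply: cvgD; first exact: cvg_cst.
  have H : {for z, continuous (fun z : R => W (s * (1 + z)) ^+ 2)}.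
    rewrite (_ : (fun z : R => W (s * (1 + z)) ^+ 2) =
      (fun y => y ^+ 2) \o (fun z : R => W (s * (z + 1)))); last first.
      by apply/funext => y /=; rewrite addrC.
    apply: continuous_comp; last exact: exprn_continuous.
    exact: (is_derive_continuous (dWs z z0)).
  exact: H.
have dG (z : R) : 0 <= z -> is_derive z 1 G (g z).
  move=> z0.
  have H := is_deriveN (is_deriveM (dWs z z0) (is_deriveM
    (is_derive_expRM (- (s * c)) z) (is_derive_powR_shift (- D) (z1 _ z0)))).
  apply: (is_derive_eq H); rewrite !fctE /GRing.scale/= /dW /g.
  rewrite (_ : - (s * (c * z)) = - (s * c) * z); last by ring.
  rewrite (addrC 1 z).
  have -> : (z + 1) `^ (- D) = (z + 1) * (z + 1) `^ (- D - 1).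
    rewrite -{2}[z + 1]powRr1 ?ltW ?z1// -powRD ?(gt_eqF (z1 _ z0)) ?implybT//.
    by congr (_ `^ _); ring.
  move: (W _) (expR _) (_ `^ _) => w e p; rewrite /D; field.
  by rewrite !gt_eqF// z1.
have Gl : G z @[z --> +oo%R] --> (0 : R).
  apply: (@squeeze_cvgr _ _ _ _ (fun z => - (a * expR (- (s * c * z)))) (fun=> 0)).
  + near=> z; have z0 : 0 <= z by near: z; exact: nbhs_pinfty_ge.
    have /andP[w0 wa] := kummer_elasticity_bounds (ltW (sz z z0)).
    rewrite /G lerN2 oppr_le0 mulr_ge0 ?mulr_ge0 ?expR_ge0 ?powR_ge0// andbT.
    rewrite -(mulNr (s * c)) ler_pM ?mulr_ge0 ?expR_ge0 ?powR_ge0//.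
    rewrite ler_piMr ?expR_ge0// powRN invf_le1 ?powR_gt0 ?z1//.
    by rewrite -[leLHS](powRr0 (z + 1)) ler_powR ?(ltW D0)// lerDr.
  + have H : a * expR (- (s * c * z)) @[z --> +oo] --> a * 0.
      by apply: cvgMr; apply: expRN_cvgy; exact: mulr_gt0.
    have := cvgN H; rewrite mulr0 oppr0 => H1; exact: H1.
  + exact: cvg_cst.
rewrite (pos_integral_FTC2y g0 cg dG Gl).
by rewrite /G /= !add0r mulr1 mulr0 expR0 powR1 !mulr1 opprK.
Unshelve. all: by end_near. Qed.
End log_derivative.

(** * Selfdecomposability *)

Section finite_measures.
Context {R : realType}.

Lemma finite_measure_of (m : {measure set R -> \bar R}) : (m setT < +oo)%E ->
  exists m' : {finite_measure set R -> \bar R},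
    (forall A, measurable A -> m' A = m A) /\
    (forall f : R -> \bar R, \int[m']_x f x = \int[m]_x f x)%E.
Proof.
move=> mT; exists (mfrestr measurableT mT).
have E A : mfrestr measurableT mT A = m A by rewrite /mfrestr /mrestr setIT.
by split => [A _|f]; [exact: E|apply: eq_measure_integral => A _ _; exact: E].
Qed.

Lemma probability_of (m : {measure set R -> \bar R}) : m setT = 1%E ->
  exists P : probability R R,
    (forall A, measurable A -> P A = m A) /\
    (forall f : R -> \bar R, \int[P]_x f x = \int[m]_x f x)%E.
Proof.
move=> mT; exists (mnormalize m (dirac (0 : R))).
have E A : mnormalize m (dirac (0 : R)) A = m A.
  by rewrite /mnormalize mT /= orbF onee_eq0 invr1 mule1.
by split => [A _|f]; [exact: E|apply: eq_measure_integral => A _ _; exact: E].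
Qed.
End finite_measures.

(** * Quotients of the transform at two scales *)

Section laplace_quotient.
Context {R : realType}.
Notation mu := (@lebesgue_measure R).
Variables a b c : R.
Hypotheses (a0 : 0 < a) (b1 : 1 <= b) (c0 : 0 < c).
Hypothesis f_lty : (\int[mu]_(x in `]0%R, +oo[)
  (x `^ (a - 1) * (x + c) `^ (- (a + b)))%:E < +oo)%E.
Let phi := kummer_integral a b c 0.
Let W := kummer_elasticity a b c.
Let D := 2 * a + b.
Let b0 : 0 < b. Proof. by apply: lt_le_trans b1. Qed.
Let D0 : 0 < D. Proof. by rewrite addr_gt0// mulr_gt0. Qed.
Let phi_gt0 (s : R) : 0 <= s -> 0 < phi s.
Proof.
move=> s0; apply: kummer_integral_gt0 => //.
by rewrite andbT orbC eq_sym -le_eqVlt.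
Qed.

Let W0 : W 0 = a. Proof. by rewrite /W /kummer_elasticity !mul0r subr0. Qed.

Let measurable_W (s : R) : 0 <= s ->
  measurable_fun [set: R] (fun z : R => W (s * (1 + `|z|))).
Proof.
rewrite le_eqVlt => /orP[/eqP <-|s0].
  by under eq_fun do rewrite mul0r W0; exact: measurable_cst.
apply: continuous_measurable_fun => z.
apply: (@continuous_comp _ _ _ (fun z : R => s * (1 + `|z|)) W).
  apply: cvgMr; apply: cvgD; first exact: cvg_cst.
  exact: norm_continuous.
have sz : 0 < s * (1 + `|z|) by rewrite mulr_gt0// ltr_wpDr.
exact: (is_derive_continuous (is_derive_kummer_elasticity a0 b1 c0 f_lty sz)).
Qed.

Lemma is_laplace_kummer_elasticity : is_laplace W.
Proof.
have kT : (dmeas (pareto_pdf D) setT < +oo)%E by rewrite pareto_mass// ltry.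
have [kappa [kE kI]] := finite_measure_of kT.
apply: (@is_laplace_quadratic_fixpoint _ kappa D a (a * (a + b)) c) => //.
- rewrite kE//; exact: pareto_mass.
- exact: ltW.
- by rewrite /D ltrDl.
- by rewrite mulr_ge0 ?addr_ge0// ltW.
- exact: ltW.
- by move=> s s0; exact: kummer_elasticity_bounds.
move=> s s0; rewrite kI integral_pareto_pdf.
- rewrite -[RHS](kummer_elasticity_fixpoint a0 b1 c0 f_lty s0); apply: eq_integral => z.
  by rewrite inE/= in_itv/= andbT => z0; rewrite gtr0_norm.
- apply: measurable_funM.
    apply: measurableT_comp => //; apply: measurableT_comp => //.
    by apply: measurable_funM => //; apply: measurable_funM.
  by apply: measurable_funD => //; apply: measurable_funX; exact: measurable_W.
- move=> x; rewrite mulr_ge0 ?expR_ge0// addr_ge0 ?sqr_ge0//.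
  by rewrite mulr_ge0 ?addr_ge0// ltW.
Qed.

Variable q : R.
Hypothesis q01 : 0 < q < 1.

Let q0 : 0 < q. Proof. by case/andP: q01. Qed.

Let kpdf (u : R) := if u \in `[q, 1] then u^-1 else 0.

Let kpdf_ge0 u : 0 <= kpdf u.
Proof.
rewrite /kpdf; case: ifPn => //; rewrite in_itv/= => /andP[qu _].
by rewrite invr_ge0 (le_trans (ltW q0)).
Qed.

Let measurable_kpdf : measurable_fun setT kpdf.
Proof.
rewrite (_ : kpdf = (fun u => u^-1) \_ `[q, 1]); last first.
  by apply/funext => u; rewrite patchE mem_setE.
apply/(measurable_restrictT (fun u : R => u^-1) (measurable_itv `[q, 1])).
by apply: measurable_funTS; exact: measurable_invr.
Qed.

Let integral_kpdf (h : R -> R) : measurable_fun setT h -> (forall x, 0 <= h x) ->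
  (\int[dmeas kpdf]_u (h u)%:E = \int[mu]_(u in `[q, 1%R]) (h u / u)%:E)%E.
Proof.
move=> mh h0; rewrite (integral_dmeas measurable_kpdf kpdf_ge0); last 2 first.
- exact/measurable_EFinP.
- by move=> x; rewrite lee_fin.
rewrite [RHS]integral_mkcond; apply: eq_integral => u _.
rewrite patchE mem_setE -EFinM /kpdf; case: ifPn => // _.
by rewrite mulr0.
Qed.

Let inv_continuous (x : R) : 0 < x -> {for x, continuous (fun x : R => x^-1)}.
Proof. by move=> x0; apply: cvgV => //; rewrite gt_eqF. Qed.

(** [W(s u) / u] has the primitive [ln phi(s u) + a ln u] in [u]; the term [- a ln q] comes from the
    constant [a] in [W] and is undone by the factor [q^a] in the quotient. *)
Let L (s : R) := ln (phi s) - ln (phi (s * q)) - a * ln q.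

Let aln_derive (u : R) : 0 < u -> is_derive u 1 (fun u => a * ln u) (a / u).
Proof.
move=> u0; have H := is_deriveZ a (is_derive1_ln u0).
exact: (is_derive_eq H).
Qed.

Let integral_W (s : R) : 0 <= s ->
  (\int[mu]_(u in `[q, 1%R]) (W (s * u) / u)%:E = (L s)%:E)%E.
Proof.
have q1 : q < 1 by case/andP: q01.
rewrite le_eqVlt => /orP[/eqP <-|s0].
  under eq_integral do rewrite mul0r W0.
  have cf (x : R) : 0 < x -> {for x, continuous (fun u : R => a / u)}.
    by move=> x0; apply: cvgMr; exact: inv_continuous.
  rewrite (pos_FTC2 cf aln_derive q0 q1).
  by rewrite ln1 mulr0 /L mul0r subrr.
pose F (u : R) := ln (phi (s * u)) + a * ln u.
have dF (u : R) : 0 < u -> is_derive u 1 F (W (s * u) / u).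
  move=> u0; have su : 0 < s * u by rewrite mulr_gt0.
  have i1 : is_derive u 1 (fun u => s * u) s.
    have H := is_deriveZ s (is_derive_id u 1).
    by apply: (is_derive_eq H); rewrite /GRing.scale/= mulr1.
  have i2 := @is_derive1_comp R phi (fun u => s * u) u _ _
    (is_derive_kummer_integral f_lty 0 su) i1.
  have i3 := @is_derive1_comp R (@ln R) (phi \o (fun u => s * u)) u _ _
    (is_derive1_ln (phi_gt0 (ltW su))) i2.
  have H := is_deriveD i3 (aln_derive u0).
  apply: (is_derive_eq H); rewrite /W /kummer_elasticity /=.
  have := phi_gt0 (ltW su); rewrite /phi.
  move: (kummer_integral _ _ _ 0 _) (kummer_integral _ _ _ 1 _) => x y x0.
  by field; rewrite !gt_eqF.
have cW (u : R) : 0 < u -> {for u, continuous (fun u => W (s * u) / u)}.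
  move=> u0; apply: cvgM; last exact: inv_continuous.
  apply: (@continuous_comp _ _ _ (fun u : R => s * u) W).
    by apply: cvgMr; exact: cvg_id.
  have su : 0 < s * u by rewrite mulr_gt0.
  exact: (is_derive_continuous (is_derive_kummer_elasticity a0 b1 c0 f_lty su)).
rewrite (pos_FTC2 cW dF q0 q1).
by rewrite /F ln1 mulr0 addr0 mulr1 -EFinB /L opprD addrA.
Qed.

Lemma is_laplace_kummer_quotient : is_laplace (fun s => phi s / phi (s * q)).
Proof.
have q1 : q < 1 by case/andP: q01.
have kT : (dmeas kpdf setT < +oo)%E.
  rewrite -[X in (X < _)%E]mul1e -integral_cst//.
  rewrite (_ : cst 1%E = fun x : R => (1 : R)%:E)// integral_kpdf//.
  have cf (x : R) : 0 < x -> {for x, continuous (fun u : R => 1 / u)}.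
    by move=> x0; apply: cvgMr; exact: inv_continuous.
  have dF (x : R) : 0 < x -> is_derive x 1 (@ln R) (1 / x).
    by move=> x0; rewrite div1r; exact: is_derive1_ln.
  by rewrite (pos_FTC2 cf dF q0 q1) ltry.
have [kappa [kE kI]] := finite_measure_of kT.
have lL : is_laplace L.
  apply: (@is_laplace_mixture _ kappa (fun=> 0) normr W) => //.
    exact: is_laplace_kummer_elasticity.
  move=> s s0; rewrite kI.
  under eq_integral do rewrite mulr0 oppr0 expR0 mul1r.
  rewrite integral_kpdf.
  - rewrite -[RHS](integral_W s0); apply: eq_integral => u; rewrite inE/= in_itv/= => /andP[qu _].
    by rewrite ger0_norm// (le_trans (ltW q0)).
  - apply: measurable_is_laplace_comp => //; first exact: is_laplace_kummer_elasticity.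
      by apply: measurable_funM => //; exact: measurableT_comp.
    by move=> u; rewrite mulr_ge0.
  - move=> u; have su : 0 <= s * `|u| by rewrite mulr_ge0.
    by have /andP[] := kummer_elasticity_bounds a0 b1 c0 f_lty su.
have := is_laplaceM (is_laplace_cst (powR_ge0 q a)) (is_laplace_expR lL).
apply: eq_is_laplace => s s0.
have sq : 0 <= s * q by rewrite mulr_ge0// ltW.
rewrite gt0_powRE// -expRD /L addrC subrK expRD expRN.
move: (lnK (phi_gt0 s0)) (lnK (phi_gt0 sq)); move: (phi s) (phi (s * q)) => u v -> ->.
by [].
Qed.
End laplace_quotient.

(** * The factor complementing a dilation of [rho] *)

Section selfdecomposability.
Context {R : realType}.
Notation mu := (@lebesgue_measure R).
Variables t th lam : R.
Hypotheses (t0 : 0 < t) (th0 : 0 < th) (lam1 : 1 < lam).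
Let l0 : 0 < lam - 1. Proof. by rewrite subr_gt0. Qed.
Let a := t / (th * (lam - 1)).
Let b := 1 + t / th.
Let c := t * (lam - 1).
Let a0 : 0 < a. Proof. by rewrite divr_gt0// mulr_gt0. Qed.
Let b1 : 1 <= b. Proof. by rewrite lerDl divr_ge0// ltW. Qed.
Let c0 : 0 < c. Proof. by rewrite mulr_gt0. Qed.

Let ZE : Zpot t th lam = (\int[mu]_(x in `]0%R, +oo[)
  (x `^ (a - 1) * (x + c) `^ (- (a + b)))%:E)%E.
Proof.
apply: eq_integral => x; rewrite inE/= in_itv/= andbT => x0.
by rewrite expR_Vpot.
Qed.

Let f_lty : (\int[mu]_(x in `]0%R, +oo[)
  (x `^ (a - 1) * (x + c) `^ (- (a + b)))%:E < +oo)%E.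
Proof. by rewrite -ZE (rho_gamma_ratio t0 th0 lam1).1 ltry. Qed.

Let phi := kummer_integral a b c 0.

Let Z := fine (Zpot t th lam).

Let phi_gt0 (s : R) : 0 <= s -> 0 < phi s.
Proof.
move=> s0; apply: kummer_integral_gt0 => //.
by rewrite andbT orbC eq_sym -le_eqVlt.
Qed.

Let Z_gt0 : 0 < Z.
Proof.
have := phi_gt0 (lexx 0); rewrite /phi /kummer_integral /Rintegral /Z ZE.
congr (0 < fine _); apply: eq_integral => x _.
by rewrite mul0r oppr0 expR0 expr0 !mul1r.
Qed.

Lemma rho_lt0 : rho t th lam `]-oo, 0[%classic = 0%E.
Proof.
rewrite /rho dmeasE; [|exact: measurable_rho_pdf|exact: rho_pdf_ge0].
apply: integral0_eq => x; rewrite /= in_itv/= => x0.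
by rewrite /rho_pdf ltNge ltW.
Qed.

Lemma rho_laplace (s : R) : 0 <= s ->
  (\int[rho t th lam]_x (expR (- (s * `|x|)))%:E = (phi s / Z)%:E)%E.
Proof.
move=> s0; rewrite (integral_dmeas (measurable_rho_pdf t th lam) (rho_pdf_ge0 t th lam));
  last 2 first.
- exact: measurable_expRNM.
- by move=> x; rewrite lee_fin expR_ge0.
have phiE : (\int[mu]_(x in `]0%R, +oo[)
    (expR (- (s * x)) * (x ^+ 0 * (x `^ (a - 1) * (x + c) `^ (- (a + b)))))%:E =
   (phi s)%:E)%E.
  by apply: (kummer_integralE f_lty); rewrite andbT orbC eq_sym -le_eqVlt.
rewrite EFinM -phiE muleC -ge0_integralZl//; last 3 first.
- apply/measurable_EFinP; apply: measurable_funTS; exact: measurable_kummer.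
- by move=> x /=; rewrite in_itv/= andbT => x0; rewrite lee_fin mulr_ge0 ?expR_ge0//
    mulr_ge0 ?exprn_ge0 ?(ltW x0)// mulr_ge0 ?powR_ge0.
- by rewrite lee_fin invr_ge0 ltW.
under [RHS]eq_integral do rewrite -EFinM.
rewrite integral_ifpos; apply: eq_integral => x _; rewrite -EFinM; congr EFin.
rewrite /rho_pdf; case: ltP => x0; last by rewrite mulr0.
by rewrite (expR_Vpot t0 th0 lam1 x0) gtr0_norm// expr0 mul1r; ring.
Qed.

(** [rho] has no mass on the nonpositive half-line, so [y] may be replaced by [|y|], the form in
    which transforms are handled. *)
Lemma rho_abs (x q : R) (B : set R) :
  rho t th lam [set y | x + q * y \in B] = rho t th lam [set y | x + q * `|y| \in B].
Proof.
rewrite /rho !dmeasE; try by [exact: measurable_rho_pdf|exact: rho_pdf_ge0].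
rewrite [LHS]integral_mkcond [RHS]integral_mkcond; apply: eq_integral => y _.
rewrite !patchE /rho_pdf; case: ltP => y0; last by rewrite !if_same.
rewrite (_ : (y \in [set y | x + q * y \in B]) = (y \in [set y | x + q * `|y| \in B]))//.
by apply/idP/idP; rewrite !inE /= gtr0_norm.
Qed.

Lemma selfdecomposable_rho : selfdecomposable (rho t th lam).
Proof.
move=> q q01; have q0 : 0 < q by case/andP: q01.
have [rf [rE rI]] : exists m' : {finite_measure set R -> \bar R},
    (forall A, measurable A -> m' A = rho t th lam A) /\
    (forall f : R -> \bar R, \int[m']_x f x = \int[rho t th lam]_x f x)%E.
  by apply: finite_measure_of; rewrite [X in (X < _)%E](rhoT t0 th0 lam1) ltry.
have [nu1 nu1E] := is_laplace_finite (is_laplace_kummer_quotient a0 b1 c0 f_lty q01).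
have nu1E' : forall s, 0 <= s ->
    (\int[nu1]_x (expR (- (s * `|x|)))%:E = (phi s / phi (s * q))%:E)%E := nu1E.
have nu1T : nu1 setT = 1%E.
  have := nu1E 0 (lexx _); under eq_integral do rewrite mul0r oppr0 expR0.
  rewrite integral_cst// mul1e => ->; rewrite mul0r divff// gt_eqF//.
  exact: phi_gt0.
have mnorm : measurable_fun [set: R] (@normr _ R) by exact: normr_measurable.
(* [nu1] is known only through [|x|], so the complementary law is its image under [normr]; its mass
   is one because the quotient is [1] at [s = 0]. *)
have [nu [nuE nuI]] : exists P : probability R R,
    (forall A, measurable A -> P A = pushforward nu1 (@normr _ R) A) /\
    (forall f : R -> \bar R, measurable_fun setT f -> (forall x, 0 <= f x)%E ->
      \int[P]_x f x = \int[nu1]_x f `|x|%R)%E.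
  have [m [mE mI]] : exists m : {measure set R -> \bar R},
      (forall A, m A = pushforward nu1 (@normr _ R) A) /\
      (forall f : R -> \bar R, measurable_fun setT f -> (forall x, 0 <= f x)%E ->
        \int[m]_x f x = \int[nu1]_x f `|x|%R)%E.
    unshelve eexists (pushforward nu1 (@normr _ R)); first exact: mnorm.
    by split=> // f mf f0; rewrite (ge0_integral_pushforward mnorm).
  have mT : m setT = 1%E by rewrite mE /pushforward preimage_setT.
  have [P [PE PI]] := probability_of mT.
  by exists P; split => [A mA|f mf f0]; [rewrite PE// mE|rewrite PI mI].
exists nu => B mB.
pose h (p : R * R) := `|p.1| + q * `|p.2|.
have mh : measurable_fun [set: R * R] h.
  apply: measurable_funD; first exact: measurableT_comp.
  by apply: measurable_funM => //; exact: measurableT_comp.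
have h0 p : 0 <= h p by rewrite addr_ge0// mulr_ge0// ltW.
(* The law of [|X| + q |Y|] for independent [X] from [nu1] and [Y] from [rho]; it has no negative
   mass, as [laplace_unique] demands. *)
have [P2 [P2E P2I]] : exists m : {measure set R -> \bar R},
    (forall A, m A = pushforward (nu1 \x rf)%E h A) /\
    (forall f : R -> \bar R, measurable_fun setT f -> (forall x, 0 <= f x)%E ->
      \int[m]_x f x = \int[nu1 \x rf]_p f (h p))%E.
  unshelve eexists (pushforward (nu1 \x rf)%E h); first exact: mh.
  by split=> // f mf f0; rewrite (ge0_integral_pushforward mh).
have aconvP2 : aconv nu (Dil q (rho t th lam)) B = P2 B.
  have mA : measurable [set p : R * R | p.1 + q * p.2 \in B].
    have mg : measurable_fun [set: R * R] (fun p => p.1 + q * p.2).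
      by apply: measurable_funD => //; exact: measurable_funM.
    have := mg measurableT _ mB; rewrite setTI (_ : _ @^-1` B = [set p | p.1 + q * p.2 \in B])//.
    by apply/seteqP; split=> p /=; rewrite inE.
  have gE x : Dil q (rho t th lam) [set y | (x + y)%R \in B] =
      rf (xsection [set p : R * R | p.1 + q * p.2 \in B] x).
    have mS : measurable (xsection [set p : R * R | p.1 + q * p.2 \in B] x).
      exact: measurable_xsection.
    rewrite rE// /Dil; congr (rho _ _ _ _); apply/seteqP; split=> [_ /= [y yB <-]|y].
      by rewrite /xsection /=; apply: mem_set; rewrite /= mulrC divfK ?gt_eqF.
    rewrite /xsection /= => /set_mem /= yB; exists (q * y) => //.
    by rewrite mulrAC divff ?mul1r// gt_eqF.
  rewrite /aconv; under eq_integral do rewrite gE.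
  rewrite nuI; [|exact: measurable_fun_xsection|by []].
  rewrite P2E; apply: eq_integral => x _ /=.
  have mS : measurable (xsection (h @^-1` B) x).
    by apply: measurable_xsection; rewrite -[X in measurable X]setTI; exact: mh.
  have mS' : measurable (xsection [set p : R * R | p.1 + q * p.2 \in B] `|x|).
    exact: measurable_xsection.
  rewrite (rE _ mS) (rE _ mS').
  rewrite (_ : xsection _ _ = [set y | `|x| + q * y \in B]); last first.
    apply/seteqP; split=> y; rewrite /xsection /=; first by move=> /set_mem.
    by move=> yB; apply: mem_set.
  rewrite rho_abs (_ : xsection _ _ = [set y | `|x| + q * `|y| \in B])//.
(* [phi (s * q)] cancels between the quotient and the transform of the dilated law. *)
have P2L s : 0 <= s -> (\int[P2]_x (expR (- (s * `|x|)))%:E = (phi s / Z)%:E)%E.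
  move=> s0; have sq0 : 0 <= s * q by rewrite mulr_ge0// ltW.
  rewrite P2I; [|exact: measurable_expRNM|by move=> x; rewrite lee_fin expR_ge0].
  have mE : measurable_fun [set: R * R] (fun p => (expR (- (s * `|h p|)))%:E).
    apply/measurable_EFinP; apply: measurableT_comp => //.
    apply: measurableT_comp => //; apply: measurable_funM => //.
    exact: measurableT_comp.
  have E0 p : (0 <= (expR (- (s * `|h p|)))%:E)%E by rewrite lee_fin expR_ge0.
  rewrite (fubini_tonelli1 (fun p => (expR (- (s * `|h p|)))%:E) mE E0).
  rewrite /fubini_F.
  under eq_integral => x _.
    under eq_integral do rewrite /= (ger0_norm (h0 _)) /h/= mulrDr opprD expRD EFinM mulrA.
    rewrite ge0_integralZl//; [|exact: measurable_expRNM].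
    rewrite rI rho_laplace//.
    over.
  rewrite ge0_integralZr//; [|exact: measurable_expRNM|]; last first.
    by rewrite lee_fin divr_ge0 ?ltW// phi_gt0.
  have p1 := phi_gt0 sq0; rewrite (nu1E' s s0) -EFinM; congr EFin.
  move: (phi s) (phi (s * q)) p1 => u v v0.
  by rewrite mulrA divfK// gt_eqF.
have P2T : (P2 setT < +oo)%E.
  have := P2L 0 (lexx _); under eq_integral do rewrite mul0r oppr0 expR0.
  by rewrite integral_cst// mul1e => ->; rewrite ltry.
have [P3 [P3E P3I]] := finite_measure_of P2T.
rewrite aconvP2 -(rE B mB) -(P3E B mB).
apply: laplace_unique mB => //.
- by move=> s s0; rewrite rI P3I rho_laplace// P2L.
- by rewrite rE// rho_lt0.
- rewrite P3E// P2E /pushforward (_ : h @^-1` _ = set0) ?measure0//.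
  by apply/seteqP; split=> // p /=; rewrite in_itv/= ltNge h0.
Qed.
End selfdecomposability.

(** * Gamma with unit parameters as the exponential law *)

Section exponential.
Context {R : realType}.
Notation mu := (@lebesgue_measure R).

Lemma Gamma1 : Gamma (1 : R) = 1.
Proof.
apply: EFin_inj; rewrite -Gamma_integral//.
transitivity (\int[mu]_(x in `]0%R, +oo[) (expR (- x))%:E)%E.
  by apply: eq_integral => x _; rewrite subrr powRr0 mul1r.
have dG (x : R) : 0 <= x -> is_derive x 1 (fun x : R => - expR (- 1 * x)) (expR (- x)).
  move=> _; have H := is_deriveN (is_derive_expRM (- 1) x).
  by apply: (is_derive_eq H); rewrite !mulN1r opprK.
have cg (x : R) : 0 <= x -> {for x, continuous (fun x : R => expR (- x))}.
  move=> _; have := is_derive_continuous (is_derive_expRM (- 1) x).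
  by rewrite (_ : (fun x => expR (- 1 * x)) = fun x => expR (- x))//;
    apply/funext => y; rewrite mulN1r.
have Gl : (fun x : R => - expR (- 1 * x)) x @[x --> +oo%R] --> - (0 : R).
  apply: cvgN; rewrite (_ : (fun x => expR (- 1 * x)) = fun x => expR (- (1 * x))).
    exact: expRN_cvgy.
  by apply/funext => y; rewrite mulNr.
rewrite (pos_integral_FTC2y (fun x _ => expR_ge0 _) cg dG Gl).
by rewrite mulr0 expR0 oppr0 -EFinB sub0r opprK.
Qed.

Lemma gamma_dist11 (A : set R) : measurable A ->
  gamma_dist 1 1 A = exponential_prob 1 A.
Proof.
move=> mA; rewrite /gamma_dist dmeasE; last 2 first.
- exact: measurable_gamma_pdf.
- exact: gamma_pdf_ge0.
have mE : measurable_fun [set: R] (fun x : R => (expR (- x))%:E).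
  by apply/measurable_EFinP; exact: measurableT_comp.
have -> : (\int[mu]_(x in A) (gamma_pdf 1 1 x)%:E =
    \int[mu]_(x in A `&` `]0%R, +oo[) (expR (- x))%:E)%E.
  rewrite [RHS]integral_mkcondr; apply: eq_integral => x _.
  rewrite patchE mem_setE in_itv/= andbT /gamma_pdf; case: ifPn => // x0.
  by rewrite subrr powRr0 powR1 Gamma1 !mul1r !divr1.
have -> : exponential_prob 1 A = (\int[mu]_(x in A `&` `[0%R, +oo[) (expR (- x))%:E)%E.
  rewrite [RHS]integral_mkcondr; apply: eq_integral => x _.
  by rewrite /exponential_pdf !patchE; case: ifPn => //; rewrite mulN1r mul1r.
(* The exponential density lives on the closed half-line and [gamma_pdf] on the open one; they
   differ only at the point [0]. *)
rewrite -[RHS](@integral_setD1 _ _ 0).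
- congr (integral _ _ _); apply/seteqP; split=> x /=; rewrite !in_itv/= !andbT.
    by move=> [Ax x0]; split; [split=> //; exact: ltW|apply/eqP; rewrite gt_eqF].
  by move=> [[Ax x0] /eqP x0']; split=> //; rewrite lt_neqAle eq_sym x0'.
- by apply: measurableD => //; exact: measurableI.
- exact: measurable_funTS.
Qed.
End exponential.

Unset Implicit Arguments.
Theorem theorem5p2 (R : realType) (t th lam : R) :
  0 < t -> 0 < th -> 1 < lam ->
  (forall B : set R, measurable B ->
     rho t th lam B =
       Dil (t * (lam - 1))
         (mconv (gamma_dist (t / (th * (lam - 1))) 1)
                (inv_meas (gamma_dist (1 + t / th) 1))) B
   /\ rho t th lam B =
       mconv (rho t th 1)
         (gamma_dist (t / (th * (lam - 1))) (th * (lam - 1) / t)) B)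
  /\ selfdecomposable (rho t th lam)
  /\ (forall B : set R, measurable B ->
        rho t th (1 + t / th) B = mconv (rho t th 1) (gamma_dist 1 1) B)
  /\ (exists nu : probability R R,
        nu `[0%R, +oo[%classic = 1%E /\
        forall B : set R, measurable B ->
          rho t th (1 + t / th) B = mconv nu (exponential_prob 1) B).
Proof.
move=> t0 th0 lam1.
have tth0 : 0 < t / th by rewrite divr_gt0.
have lam2 : 1 < 1 + t / th by rewrite ltrDl.
have mixE B : measurable B ->
    rho t th (1 + t / th) B = mconv (rho t th 1) (gamma_dist 1 1) B.
  move=> mB; rewrite (rho_rho1_gamma t0 th0 lam2 mB).
  (* At [lam - 1 = t / th] both the shape and the scale of the gamma law equal [1]. *)
  have -> : 1 + t / th - 1 = t / th by ring.
  have -> : th * (t / th) = t by field; rewrite gt_eqF.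
  by rewrite divff// gt_eqF.
split; [|split; [|split]].
- move=> B mB; split; first exact: rho_Dil_gamma_ratio.
  exact: rho_rho1_gamma.
- exact: selfdecomposable_rho.
- exact: mixE.
(* The mixing variable [Z] has the law [rho] at [lam = 1]. *)
have [nu [nuE nuI]] := probability_of (rho1T t0 th0).
exists nu; split.
  have rE A := dmeasE A (measurable_rho_pdf t th 1) (rho_pdf_ge0 t th 1).
  rewrite nuE// -(rho1T t0 th0) [LHS]rE [RHS]rE [LHS]integral_mkcond.
  apply: eq_integral => x _; rewrite patchE mem_setE in_itv/= andbT.
  by case: leP => // x0; rewrite /rho_pdf ltNge ltW.
move=> B mB; rewrite mixE// /mconv nuI; apply: eq_integral => x _.
apply: gamma_dist11.
have mx : measurable_fun [set: R] (fun y => x * y) by exact: measurable_funM.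
have := mx measurableT _ mB; rewrite setTI (_ : _ @^-1` B = [set y | x * y \in B])//.
by apply/seteqP; split=> y /=; rewrite inE.
Qed.
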